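(* For every non-empty set $X$, the $(2,1,0)$-algebra $\mathrm{H}(X)$ is the free left $h$-adequate monoid on $X$. That is, $\mathrm{H}(X)$ is a left $h$-adequate monoid, and for every left $h$-adequate monoid $M$ and every function $\chi : X\to M$ there is a unique $(2,1,0)$-morphism $\mathrm{H}(X)\to M$ extending $\chi$.
   Context: **Left $h$-adequate monoids.** A semigroup $S$ with a unary operation ${}^+$ is left Ehresmann if $x^+x=x$, $(x^+y^+)^+=x^+y^+=y^+x^+$ and $(xy)^+=(xy^+)^+$ for all $x,y\in S$. It is left adequate if moreover $x^2=x$ implies $x=x^+$, and $xz=yz$ implies $xz^+=yz^+$, for all $x,y,z\in S$. It is left $h$-adequate if it is left adequate and $(xz^+y)^+=(xy)^+(xz)^+$ for all $x,y,z\in S$ (the left $h$ condition). A left $h$-adequate monoid is such a structure with a multiplicative identity, regarded as a $(2,1,0)$-algebra (product, ${}^+$, identity). A $(2,1,0)$-morphism preserves all three operations. **Left $X$-trees.** Let $X$ be a non-empty set. A left $X$-tree is a finite directed tree (a finite directed graph whose underlying undirected graph is a tree), with edges labelled by elements of $X$, and two distinguished (possibly equal) vertices, start and end, such that every vertex is reachable by a directed path from the start vertex. Its trunk is the directed path from start to end. Morphisms are directed graph morphisms preserving labels, start and end. Left $X$-trees are considered up to isomorphism; $\mathrm{LUT}^1(X)$ is the set of all of them, $\mathcal{E}(X)$ the subset of those with start $=$ end, and $\varepsilon$ the one-vertex tree. Each $x\in X$ is identified with the tree consisting of a single edge labelled $x$ from the start vertex to the (distinct) end vertex. The gluing product $\Gamma\times\Delta$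 is obtained by identifying the end vertex of $\Gamma$ with the start vertex of $\Delta$; its start is that of $\Gamma$ and its end is that of $\Delta$. The tree $\Gamma^{(+)}$ is $\Gamma$ with the end vertex relocated to the start vertex. **Pruning.** A retraction on $\Gamma$ is a morphism $\phi:\Gamma\to\Gamma$ with $\phi\circ\phi=\phi$. A tree is pruned if its only retraction is the identity. It is known (Kambites) that each $\Gamma$ has a unique pruned left $X$-tree $\overline{\Gamma}$ which is the image of a retraction on $\Gamma$. **Splaying.** A leaf is a vertex that is not the initial vertex of any edge. For $B\in\mathcal{E}(X)$ and a vertex $v$, let $p_v\in\mathcal{E}(X)$ be the directed path from the start vertex of $B$ to $v$, with start and end both located at the start vertex of $B$. Put $\mathrm{Splay}(B)=\prod_{v \text{ a leaf of } B} p_v$ (gluing product, commutative on $\mathcal{E}(X)$). Each $\Gamma\in\mathrm{LUT}^1(X)$ has a unique branch decomposition $\Gamma=B_0\times x_1\times B_1\times\cdots\times x_k\times B_k$ with $x_i\in X$ the trunk labels and $B_i\in\mathcal{E}(X)$; put $\mathrm{Splay}(\Gamma)=\mathrm{Splay}(B_0)\times x_1\times\mathrm{Splay}(B_1)\times\cdots\times x_k\times\mathrm{Splay}(B_k)$. **The algebra $\mathrm{H}(X)$.** Put $\widehat{\Gamma}=\overline{\mathrm{Splay}(\Gamma)}$ and $\mathrm{H}(X)=\{\widehat{\Gamma} : \Gamma\in\mathrm{LUT}^1(X)\}$, with operations $\Gamma\Delta:=\widehat{\Gamma\times\Delta}$, $\Gamma^+:=\widehat{\Gamma^{(+)}}$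 and distinguished element $\varepsilon$. Note $X\subseteq\mathrm{H}(X)$. *)

(* Defs.v *)
From mathcomp Require Import all_boot.
From Stdlib Require Import ClassicalEpsilon FunctionalExtensionality
  PropExtensionality.

Set Implicit Arguments.
Unset Strict Implicit.
Unset Printing Implicit Defensive.

(** * Left h-adequate monoids *)

Record alg210 : Type := Alg210 {
  carrier :> Type;
  amul : carrier -> carrier -> carrier;
  aplus : carrier -> carrier;
  aone : carrier }.

Arguments aone {_}.

Declare Scope alg_scope.
Delimit Scope alg_scope with alg.
Local Notation "x * y" := (amul x y) : alg_scope.
Local Notation "x ⁺" := (aplus x) (at level 1, format "x ⁺") : alg_scope.

Section LeftHAdequate.
Local Open Scope alg_scope.
Variable M : alg210.

Definition is_monoid : Prop :=
  [/\ forall x y z : M, x * (y * z) = (x * y) * z,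
      forall x : M, aone * x = x &
      forall x : M, x * aone = x].

Definition left_ehresmann : Prop :=
  [/\ forall x : M, x⁺ * x = x,
      forall x y : M, (x⁺ * y⁺)⁺ = x⁺ * y⁺,
      forall x y : M, x⁺ * y⁺ = y⁺ * x⁺ &
      forall x y : M, (x * y)⁺ = (x * y⁺)⁺].

Definition left_adequate : Prop :=
  [/\ left_ehresmann,
      forall x : M, x * x = x -> x = x⁺ &
      forall x y z : M, x * z = y * z -> x * z⁺ = y * z⁺].

Definition left_h_condition : Prop :=
  forall x y z : M, (x * z⁺ * y)⁺ = (x * y)⁺ * (x * z)⁺.

Definition left_h_adequate_monoid : Prop :=
  [/\ is_monoid, left_adequate & left_h_condition].

End LeftHAdequate.

Definition morphism210 (M N : alg210) (f : M -> N) : Prop :=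
  [/\ forall x y : M, f (amul x y) = amul (f x) (f y),
      forall x : M, f (aplus x) = aplus (f x) &
      f aone = aone].

(** * Finite directed edge-labelled graphs with two distinguished vertices *)

Record lgraph (X : Type) : Type := LGraph {
  vertex : finType;
  edge : finType;
  source : edge -> vertex;
  target : edge -> vertex;
  label : edge -> X;
  start : vertex;
  stop : vertex }.

Arguments start {X} l.
Arguments stop {X} l.

Section Walks.
Variables (X : Type) (G : lgraph X).
Implicit Types u v : vertex G.

Fixpoint dwalk u (p : seq (edge G)) v : bool :=
  if p is e :: p' then (source e == u) && dwalk (target e) p' v else u == v.

(* A dart is an edge with a direction of traversal, [true] being the
   direction of the edge. *)
Definition dart : finType := (edge G * bool)%type.
Definition dsource (d : dart) := if d.2 then source d.1 else target d.1.
Definition dtarget (d : dart) := if d.2 then target d.1 else source d.1.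

Fixpoint uwalk u (p : seq dart) v : bool :=
  if p is d :: p' then (dsource d == u) && uwalk (dtarget d) p' v else u == v.

(* Loops and pairs of parallel or antiparallel edges are cycles. *)
Definition ucycle u (p : seq dart) : bool :=
  [&& p != [::], uwalk u p u, uniq [seq d.1 | d <- p] &
      uniq [seq dsource d | d <- p]].

Definition uconnected : Prop := forall u v, exists p, uwalk u p v.
Definition uacyclic : Prop := forall u p, ~~ ucycle u p.
Definition is_tree : Prop := uconnected /\ uacyclic.

Definition reachable : Prop := forall v, exists p, dwalk (start G) p v.

Definition is_leaf v : bool := [forall e : edge G, source e != v].

End Walks.

(** * Morphisms, isomorphisms, retractions *)

Record mor (X : Type) (G D : lgraph X) : Type := Mor {
  mvert : vertex G -> vertex D;
  medge : edge G -> edge D;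
  mor_source : forall e, source (medge e) = mvert (source e);
  mor_target : forall e, target (medge e) = mvert (target e);
  mor_label : forall e, label (medge e) = label e;
  mor_start : mvert (start G) = start D;
  mor_stop : mvert (stop G) = stop D }.

Definition iso (X : Type) (G D : lgraph X) : Prop :=
  exists phi : mor G D, bijective (mvert phi) /\ bijective (medge phi).

Definition retraction (X : Type) (G : lgraph X) (phi : mor G G) : Prop :=
  (forall v, mvert phi (mvert phi v) = mvert phi v) /\
  (forall e, medge phi (medge phi e) = medge phi e).

Definition pruned (X : Type) (G : lgraph X) : Prop :=
  forall phi : mor G G, retraction phi -> mvert phi =1 id /\ medge phi =1 id.

Section Image.
Variables (X : Type) (G : lgraph X) (phi : mor G G).

Let V : finType := {v : vertex G | v \in codom (mvert phi)}.
Let E : finType := {e : edge G | e \in codom (medge phi)}.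

Lemma image_source (e : E) : source (val e) \in codom (mvert phi).
Proof.
by case: e => e /= /codomP[f ->]; rewrite mor_source codom_f.
Qed.

Lemma image_target (e : E) : target (val e) \in codom (mvert phi).
Proof.
by case: e => e /= /codomP[f ->]; rewrite mor_target codom_f.
Qed.

Lemma image_start : start G \in codom (mvert phi).
Proof. by rewrite -(mor_start phi) codom_f. Qed.

Lemma image_stop : stop G \in codom (mvert phi).
Proof. by rewrite -(mor_stop phi) codom_f. Qed.

Definition image_graph : lgraph X :=
  let inV v (h : v \in codom (mvert phi)) : V :=
    exist (fun v => v \in codom (mvert phi)) v h in
  @LGraph X V E (fun e => inV _ (image_source e))
    (fun e => inV _ (image_target e)) (fun e => label (val e))
    (inV _ image_start) (inV _ image_stop).

End Image.

Section IsoTheory.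
Variable X : Type.
Implicit Types G D H : lgraph X.

Lemma iso_refl G : iso G G.
Proof.
exists (@Mor X G G id id (fun=> erefl) (fun=> erefl) (fun=> erefl) erefl erefl).
by split; exists id.
Qed.

Lemma iso_sym G D : iso G D -> iso D G.
Proof.
case=> phi [[gv vK gvK] [ge eK geK]].
have s e : source (ge e) = gv (source e).
  by apply: (can_inj vK); rewrite gvK -mor_source geK.
have t e : target (ge e) = gv (target e).
  by apply: (can_inj vK); rewrite gvK -mor_target geK.
have l e : label (ge e) = label e by rewrite -(mor_label phi) geK.
have a : gv (start D) = start G by rewrite -(mor_start phi) vK.
have b : gv (stop D) = stop G by rewrite -(mor_stop phi) vK.
by exists (Mor s t l a b); split; [exists (mvert phi)|exists (medge phi)].
Qed.

Lemma iso_trans G D H : iso G D -> iso D H -> iso G H.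
Proof.
case=> phi [bv be] [psi [bv' be']].
pose fv := mvert psi \o mvert phi; pose fe := medge psi \o medge phi.
have s e : source (fe e) = fv (source e) by rewrite /fv /fe /= !mor_source.
have t e : target (fe e) = fv (target e) by rewrite /fv /fe /= !mor_target.
have l e : label (fe e) = label e by rewrite /fe /= !mor_label.
have a : fv (start G) = start H by rewrite /fv /= !mor_start.
have b : fv (stop G) = stop H by rewrite /fv /= !mor_stop.
by exists (Mor s t l a b); split; apply: bij_comp.
Qed.

End IsoTheory.

(** * Walks in trees *)

Section WalkTheory.
Variables (X : Type) (G : lgraph X).
Implicit Types u v w : vertex G.

Lemma dwalk_cat u p q w :
  dwalk u (p ++ q) w <-> exists v, dwalk u p v /\ dwalk v q w.
Proof.
elim: p u => [|e p IH] u /=.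
  by split=> [h|[v [/eqP-> //]]]; exists u.
split=> [/andP[-> /IH]//|[v [/andP[-> hp] hq]]].
by apply/IH; exists v.
Qed.

Lemma uwalk_cat u p q w :
  uwalk u (p ++ q) w <-> exists v, uwalk u p v /\ uwalk v q w.
Proof.
elim: p u => [|e p IH] u /=.
  by split=> [h|[v [/eqP-> //]]]; exists u.
split=> [/andP[-> /IH]//|[v [/andP[-> hp] hq]]].
by apply/IH; exists v.
Qed.

Lemma dwalk_uwalk u p v :
  dwalk u p v -> uwalk u [seq (e, true) | e <- p] v.
Proof. by elim: p u => //= e p IH u /andP[-> /IH]. Qed.

Lemma uwalk_rev u p v :
  uwalk u p v -> exists q, uwalk v q u.
Proof.
elim: p u => [|d p IH] u /= => [/eqP->|/andP[/eqP <- /IH[q hq]]].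
  by exists [::] => /=.
exists (q ++ [:: (d.1, ~~ d.2)]); apply/uwalk_cat; exists (dtarget d).
by split=> //=; rewrite /dsource /dtarget /=; case: (d.2) => /=; rewrite !eqxx.
Qed.

Lemma reachable_connected : reachable G -> uconnected G.
Proof.
move=> h u v; have [p hp] := h u; have [q hq] := h v.
have [p' hp'] := uwalk_rev (dwalk_uwalk hp).
exists (p' ++ [seq (e, true) | e <- q]).
by apply/uwalk_cat; exists (start G); split=> //; apply: dwalk_uwalk.
Qed.

End WalkTheory.

(** * Left X-trees *)

Record ltree (X : Type) : Type := LTree {
  tgraph :> lgraph X;
  ltree_tree : is_tree tgraph;
  ltree_reachable : reachable tgraph }.

Section BasicTrees.
Variable X : Type.

Definition eps_graph : lgraph X :=
  @LGraph X unit void (of_void _) (of_void _) (of_void _) tt tt.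

Lemma eps_reachable : reachable eps_graph.
Proof. by case; exists [::]. Qed.

Lemma eps_tree : is_tree eps_graph.
Proof.
split; first exact: reachable_connected eps_reachable.
by move=> u [|[[]]].
Qed.

Definition eps : ltree X := LTree eps_tree eps_reachable.

Definition single_graph (x : X) : lgraph X :=
  @LGraph X bool unit (fun=> false) (fun=> true) (fun=> x) false true.

Lemma single_reachable x : reachable (single_graph x).
Proof. by case; [exists [:: tt]|exists [::]]. Qed.

Lemma single_tree x : is_tree (single_graph x).
Proof.
split; first exact: reachable_connected (single_reachable (x:=x)).
by move=> u [|[[] []] [|[[] b] p]] //=; rewrite /ucycle /= ?andbF //; case: u.
Qed.

Definition single x : ltree X := LTree (single_tree x) (single_reachable (x:=x)).

(* The tree with the end vertex relocated to the start vertex. *)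
Definition plus_graph (G : lgraph X) : lgraph X :=
  @LGraph X (vertex G) (edge G) (@source X G) (@target X G) (@label X G)
    (start G) (start G).

Definition plus (T : ltree X) : ltree X :=
  @LTree X (plus_graph T) (ltree_tree T) (@ltree_reachable X T).

End BasicTrees.

Arguments eps {X}.

(** * The gluing product *)

Section Glue.
Variables (X : Type) (G D : lgraph X).

(* The vertices of [D] other than its start vertex are kept, and the start
   vertex of [D] is sent to the end vertex of [G]. *)
Let V : finType := (vertex G + {v : vertex D | v != start D})%type.
Let E : finType := (edge G + edge D)%type.

Definition glue_inr (v : vertex D) : V :=
  if insub v is Some w then inr w else inl (stop G).

Definition glue_graph : lgraph X :=
  @LGraph X V E
    (fun e => match e with
      inl e => inl (source e) | inr e => glue_inr (source e) end)
    (fun e => match e with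
      inl e => inl (target e) | inr e => glue_inr (target e) end)
    (fun e => match e with inl e => label e | inr e => label e end)
    (inl (start G)) (glue_inr (stop D)).

Lemma glue_inr_start : glue_inr (start D) = inl (stop G).
Proof. by rewrite /glue_inr insubF // eqxx. Qed.

Lemma glue_inr_val (w : {v : vertex D | v != start D}) :
  glue_inr (val w) = inr w.
Proof. by rewrite /glue_inr valK. Qed.

Lemma dwalk_inl u p v :
  dwalk u p v -> @dwalk _ glue_graph (inl u) (map inl p) (inl v).
Proof.
by elim: p u => [|e p IH] u /= => [/eqP->|/andP[/eqP-> /IH ->]]; rewrite eqxx.
Qed.

Lemma dwalk_inr u p v :
  dwalk u p v -> @dwalk _ glue_graph (glue_inr u) (map inr p) (glue_inr v).
Proof.
by elim: p u => [|e p IH] u /= => [/eqP->|/andP[/eqP-> /IH ->]]; rewrite eqxx.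
Qed.

Lemma glue_reachable : reachable G -> reachable D -> reachable glue_graph.
Proof.
move=> hG hD [v|w].
  by have [p /dwalk_inl hp] := hG v; exists (map inl p).
have [p /dwalk_inl hp] := hG (stop G); have [q /dwalk_inr hq] := hD (val w).
rewrite glue_inr_start glue_inr_val in hq.
by exists (map inl p ++ map inr q); apply/dwalk_cat; exists (inl (stop G)).
Qed.

(* The projections of a glued graph onto its two factors. *)
Let pl (v : V) : vertex G := if v is inl u then u else stop G.
Let pr (v : V) : vertex D := if v is inr w then val w else start D.
Let dl (d : dart glue_graph) : option (dart G) :=
  if d.1 is inl e then Some (e, d.2) else None.
Let dr (d : dart glue_graph) : option (dart D) :=
  if d.1 is inr e then Some (e, d.2) else None.

Let pl_inr v : pl (glue_inr v) = stop G.
Proof. by rewrite /glue_inr; case: insubP. Qed.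

Let pr_inr v : pr (glue_inr v) = v.
Proof. by rewrite /glue_inr; case: insubP => [w _ //|/negbNE/eqP]. Qed.

Lemma uwalk_pl u p v :
  @uwalk _ glue_graph u p v -> uwalk (pl u) (pmap dl p) (pl v).
Proof.
elim: p u => [|[[e|e] b] p IH] u /= => [/eqP->//||] /andP[/eqP <- /IH].
  by rewrite /dsource /dtarget /=; case: b => /= ->; rewrite eqxx.
by rewrite /dsource /dtarget /=; case: b => /=; rewrite !pl_inr.
Qed.

Lemma uwalk_pr u p v :
  @uwalk _ glue_graph u p v -> uwalk (pr u) (pmap dr p) (pr v).
Proof.
elim: p u => [|[[e|e] b] p IH] u /= => [/eqP->//||] /andP[/eqP <- /IH].
  by rewrite /dsource /dtarget /=; case: b.
by rewrite /dsource /dtarget /=; case: b => /=; rewrite !pr_inr eqxx.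
Qed.

Lemma glue_acyclic : uacyclic G -> uacyclic D -> uacyclic glue_graph.
Proof.
move=> hG hD u p; apply/negP => /and4P[p0 hw ue uv].
have uel : uniq [seq d.1 | d <- pmap dl p].
  elim: p ue {p0 hw uv} => [|[[e|e] b] p IH] //= /andP[ni /IH->] //.
  rewrite andbT; apply: contra ni.
  elim: p {IH} => [|[[f|f] c] p IH] //=; rewrite !inE.
    by case/orP=> [/eqP->|/IH->]; rewrite ?eqxx ?orbT.
have uer : uniq [seq d.1 | d <- pmap dr p].
  elim: p ue {p0 hw uv uel} => [|[[e|e] b] p IH] //= /andP[ni /IH->] //.
  rewrite andbT; apply: contra ni.
  elim: p {IH} => [|[[f|f] c] p IH] //=; rewrite !inE.
    by case/orP=> [/eqP->|/IH->]; rewrite ?eqxx ?orbT.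
have uvl : uniq [seq dsource d | d <- pmap dl p].
  elim: p uv {p0 hw ue uel uer} => [|[[e|e] b] p IH] //= /andP[ni /IH->] //.
  rewrite andbT; apply: contra ni.
  elim: p {IH} => [|[[f|f] c] p IH] //=; rewrite !inE.
    case/orP=> [/eqP|/IH->]; rewrite ?orbT // /dsource /=.
    by case: b {IH}; case: c => /= ->; rewrite eqxx.
  by move=> /IH->; rewrite orbT.
have uvr : uniq [seq dsource d | d <- pmap dr p].
  elim: p uv {p0 hw ue uel uer uvl} => [|[[e|e] b] p IH] //= /andP[ni /IH->] //.
  rewrite andbT; apply: contra ni.
  elim: p {IH} => [|[[f|f] c] p IH] //=; rewrite !inE.
    by move=> /IH->; rewrite orbT.
  case/orP=> [/eqP|/IH->]; rewrite ?orbT // /dsource /=.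
  by case: b {IH}; case: c => /= ->; rewrite eqxx.
case: p p0 hw {ue uv} uel uer uvl uvr => [|[[e|e] b] p] // _ hw ul ur vl vr.
  have /negP[] := hG (pl u) (pmap dl ((inl e, b) :: p)).
  by rewrite /ucycle (uwalk_pl hw) ul vl.
have /negP[] := hD (pr u) (pmap dr ((inr e, b) :: p)).
by rewrite /ucycle (uwalk_pr hw) ur vr.
Qed.

End Glue.

Lemma glue_tree (X : Type) (S T : ltree X) : is_tree (glue_graph S T).
Proof.
have [_ hS] := ltree_tree S; have [_ hT] := ltree_tree T.
split; last exact: glue_acyclic.
by apply: reachable_connected; apply: glue_reachable; apply: ltree_reachable.
Qed.

Definition glue (X : Type) (S T : ltree X) : ltree X :=
  LTree (glue_tree S T)
    (glue_reachable (@ltree_reachable X S) (@ltree_reachable X T)).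

(** * Pruning *)

Definition is_pruning (X : Type) (T P : ltree X) : Prop :=
  pruned P /\ exists phi : mor T T, retraction phi /\ iso (image_graph phi) P.

(* A tree satisfying [is_pruning] exists and is unique up to isomorphism, by a
   theorem of Kambites; the choice operator selects one. *)
Definition prune (X : Type) (T : ltree X) : ltree X :=
  epsilon (inhabits T) (is_pruning T).

(** * Splaying *)

Section Splay.
Variable X : Type.

Definition path_to (B : ltree X) (v : vertex B) : seq (edge B) :=
  xchoose (ltree_reachable v).

(* The directed path labelled by [x_1 .. x_n] is the gluing product of the
   trees [x_1], .., [x_n]; its end is then moved to its start. *)
Definition path_tree (B : ltree X) (v : vertex B) : ltree X :=
  plus (\big[@glue X/eps]_(e <- path_to v) single (label e)).

(* For [B] with start = end; the order of the factors is immaterial up to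
   isomorphism. *)
Definition splay_branch (B : ltree X) : ltree X :=
  \big[@glue X/eps]_(v : vertex B | is_leaf v) path_tree v.

(* [unbranch f B0 [:: (x1, B1); ..; (xk, Bk)]] is
   [f B0 * x1 * f B1 * ... * xk * f Bk]. *)
Definition unbranch (f : ltree X -> ltree X) (B0 : ltree X)
    (s : seq (X * ltree X)) : ltree X :=
  foldl (fun T xB => glue (glue T (single xB.1)) (f xB.2)) (f B0) s.

Definition in_E (B : ltree X) : bool := start B == stop B.

Definition branch_decomposition (T B0 : ltree X) (s : seq (X * ltree X)) :
    Prop :=
  [/\ in_E B0, all (fun xB => in_E xB.2) s & iso T (unbranch id B0 s)].

(* The branch decomposition exists and is unique up to isomorphism of the
   branches. *)
Definition is_splaying (T S : ltree X) : Prop :=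
  exists B0 s, branch_decomposition T B0 s /\ S = unbranch splay_branch B0 s.

Definition splay (T : ltree X) : ltree X :=
  epsilon (inhabits T) (is_splaying T).

Definition hat (T : ltree X) : ltree X := prune (splay T).

End Splay.

(** * The values of [hat] on the one-vertex and the one-edge trees *)

Section Rigid.
Variable X : Type.
Implicit Types S T : ltree X.

Lemma prune_rigid T :
  (forall phi : mor T T, mvert phi =1 id /\ medge phi =1 id) ->
  iso T (prune T).
Proof.
move=> rT; pose one := @Mor X T T id id (fun=> erefl) (fun=> erefl)
  (fun=> erefl) erefl erefl.
have [] : is_pruning T (prune T).
  apply: epsilon_spec; exists T; split=> [phi _|]; first exact: rT.
  exists one; split; first by [].
  pose i : mor (image_graph one) T := @Mor X (image_graph one) T
    val val (fun=> erefl) (fun=> erefl) (fun=> erefl) erefl erefl.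
  exists i; split.
    have h v : v \in codom (@id (vertex T)) by apply/codomP; exists v.
    exists (fun v => exist _ v (h v)) => v //; exact: val_inj.
  have h e : e \in codom (@id (edge T)) by apply/codomP; exists e.
  exists (fun e => exist _ e (h e)) => e //; exact: val_inj.
move=> _ [phi [_ hP]]; apply: iso_trans hP; apply: iso_sym.
have [hv he] := rT phi.
pose i : mor (image_graph phi) T := @Mor X (image_graph phi) T
  val val (fun=> erefl) (fun=> erefl) (fun=> erefl) erefl erefl.
exists i; split.
  have h v : v \in codom (mvert phi) by apply/codomP; exists v; rewrite hv.
  exists (fun v => exist _ v (h v)) => v //; exact: val_inj.
have h e : e \in codom (medge phi) by apply/codomP; exists e; rewrite he.
exists (fun e => exist _ e (h e)) => e //; exact: val_inj.
Qed.

Lemma edgeless_vertex T (v : vertex T) : #|edge T| = 0 -> v = start T.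
Proof.
by have [[|e p] /=] := ltree_reachable v; [move/eqP | move=> _ /(fintype0 e)].
Qed.

Lemma edgeless_eps T : #|edge T| = 0 -> iso T eps.
Proof.
move=> hT; have ne (e : edge T) : False by apply: fintype0 e hT.
pose f : mor T eps := @Mor X T eps (fun=> tt) (fun e => False_rect _ (ne e))
  (fun e => match ne e with end) (fun e => match ne e with end)
  (fun e => match ne e with end) erefl erefl.
exists f; split; last by exists (of_void _) => [e|[]]; case: (ne e).
by exists (fun=> start T) => [v|[]] //=; rewrite [v]edgeless_vertex.
Qed.

Lemma edgeless_rigid T (phi : mor T T) :
  #|edge T| = 0 -> mvert phi =1 id /\ medge phi =1 id.
Proof.
move=> hT; split=> [v|e]; last by case: (fintype0 e hT).
by rewrite [v](edgeless_vertex _ hT) mor_start.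
Qed.

Section OneEdge.
Variables (T : ltree X) (e : edge T).
Hypotheses (eT : forall f : edge T, f = e) (nT : start T != stop T).

Lemma one_edge_vertex (v : vertex T) : v = start T \/ v = target e.
Proof.
have [p] := ltree_reachable v.
elim: p (start T) => [|f p IH] u /= => [/eqP|/andP[_ /IH]]; first by left.
by rewrite (eT f) => -[]; right.
Qed.

Lemma one_edge_source : source e = start T.
Proof.
have [[|f p] /=] := ltree_reachable (stop T); first by rewrite (negbTE nT).
by rewrite (eT f) => /andP[/eqP].
Qed.

Lemma one_edge_target : target e = stop T.
Proof. by case: (one_edge_vertex (stop T)) nT => -> //; rewrite eqxx. Qed.

Lemma one_edge_single : iso T (single (label e)).
Proof.
pose f : mor T (single (label e)) := @Mor X T (single (label e))
  (fun v => v == stop T) (fun=> tt)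
  ltac:(by move=> f; rewrite (eT f) one_edge_source (negbTE nT))
  ltac:(by move=> f; rewrite (eT f) one_edge_target eqxx)
  ltac:(by move=> f; rewrite (eT f)) (negbTE nT) (eqxx _).
exists f; split; last by exists (fun=> e) => [?|[]] //=; rewrite -eT.
exists (fun b : bool => if b then stop T else start T) => [v|[]] /=.
- by case: eqP => // hv; case: (one_edge_vertex v) => // hw;
    case: hv; rewrite hw one_edge_target.
- by rewrite eqxx.
- exact: negbTE.
Qed.

Lemma one_edge_rigid (phi : mor T T) : mvert phi =1 id /\ medge phi =1 id.
Proof.
split=> [v|f]; last by rewrite (eT f) [LHS]eT.
case: (one_edge_vertex v) => ->; first exact: mor_start.
by rewrite one_edge_target mor_stop.
Qed.

End OneEdge.

Lemma card_edge_glue S T : #|edge (glue S T)| = #|edge S| + #|edge T|.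
Proof. exact: card_sum. Qed.

Lemma iso_card_edge S T : iso S T -> #|edge S| = #|edge T|.
Proof. by case=> phi [_ /bij_eq_card]. Qed.

Lemma splay_branch_edgeless (B : ltree X) : #|edge B| = 0 -> #|edge (splay_branch B)| = 0.
Proof.
move=> hB; rewrite /splay_branch.
elim/big_rec: _ => [|v T _ hT]; first exact: card_void.
rewrite card_edge_glue hT addn0 /path_tree.
case: (path_to v) => [|e p]; last by case: (fintype0 e hB).
by rewrite big_nil; apply: card_void.
Qed.

Lemma card_edge_unbranch (B0 : ltree X) s : size s <= #|edge (unbranch id B0 s)|.
Proof.
rewrite /unbranch; elim/last_ind: s => //= s [x B] IH.
rewrite size_rcons foldl_rcons !card_edge_glue /= card_unit addn1.
by rewrite addSn ltnS (leq_trans IH) ?leq_addr.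
Qed.

Section Sandwich.
Variables (S T : ltree X) (y : X).
Hypotheses (S0 : #|edge S| = 0) (T0 : #|edge T| = 0).

Let U := glue (glue S (single y)) T.
Let e : edge U := inl (inr tt).

Let eU (f : edge U) : f = e.
Proof. by case: f => [[f|[]]|f] //; case: (fintype0 f). Qed.

Let nU : start U != stop U.
Proof.
rewrite /= [stop T](edgeless_vertex _ T0) glue_inr_start /= /glue_inr.
by case: insubP.
Qed.

Lemma sandwich_iso : iso U (single y).
Proof. exact: (one_edge_single eU nU). Qed.

Lemma sandwich_rigid (phi : mor U U) : mvert phi =1 id /\ medge phi =1 id.
Proof. exact: (one_edge_rigid eU nU). Qed.

End Sandwich.

Lemma hat_eps : iso (@eps X) (hat eps).
Proof.
have [B0 [s [[_ _ h] hS]]] : is_splaying eps (splay (@eps X)).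
  apply: epsilon_spec; exists (unbranch (@splay_branch X) eps [::]), eps, [::].
  by split=> //; split=> //; apply: iso_refl.
have := card_edge_unbranch B0 s.
rewrite -(iso_card_edge h) card_void leqn0 => /nilP s0; subst s.
have /splay_branch_edgeless e0 : #|edge B0| = 0.
  by rewrite -(iso_card_edge h) card_void.
rewrite /hat hS /unbranch /=; apply: iso_trans (iso_sym (edgeless_eps e0)) _.
by apply: prune_rigid => phi; apply: edgeless_rigid.
Qed.

Lemma hat_single (x : X) : iso (single x) (hat (single x)).
Proof.
have [B0 [s [[h0 hs h] hS]]] : is_splaying (single x) (splay (single x)).
  apply: epsilon_spec.
  exists (unbranch (@splay_branch X) eps [:: (x, eps)]), eps, [:: (x, eps)].
  split=> //; split=> //; apply: iso_sym.
  by apply: sandwich_iso; apply: card_void.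
have c : #|edge (unbranch id B0 s)| = 1.
  by rewrite -(iso_card_edge h) card_unit.
case: s hs h hS c => [|[y B1] [|z s]] hs h hS c.
- case: h => phi [[g gK _] _].
  have := congr1 g (eqP h0); rewrite /= -(mor_start phi) -(mor_stop phi).
  by rewrite /unbranch /= !gK.
- have {}c : #|edge (glue (glue B0 (single y)) B1)| = 1 by [].
  move: c; rewrite !card_edge_glue card_unit addn1 addSn => -[].
  move/eqP; rewrite addn_eq0 => /andP[/eqP c0 /eqP c1].
  have xy : x = y.
    case: h => phi _; have := mor_label phi tt; rewrite /= => <-.
    by case: (medge phi tt) => [[e|[]]|e] //=; case: (fintype0 e).
  have c0' := splay_branch_edgeless c0; have c1' := splay_branch_edgeless c1.
  rewrite /hat hS xy /unbranch /=.
  apply: iso_trans (iso_sym (sandwich_iso y c0' c1')) _.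
  by apply: prune_rigid => phi; apply: sandwich_rigid.
have := card_edge_unbranch B0 ((y, B1) :: z :: s).
by rewrite c.
Qed.
End Rigid.

(** * The algebra H(X) *)

Section HX.
Variable X : Type.

(* Left X-trees are taken up to isomorphism: a tree stands for its class. *)
Definition tclass (T : ltree X) : ltree X -> Prop := fun S => iso T S.

Lemma tclass_eq (S T : ltree X) : iso S T -> tclass S = tclass T.
Proof.
move=> h; apply: functional_extensionality => U.
apply: propositional_extensionality; split; last exact: iso_trans.
by apply: iso_trans; apply: iso_sym.
Qed.

Definition in_H (c : ltree X -> Prop) : Prop := exists T, c = tclass (hat T).

Record H_carrier : Type := HElt {
  hclass : ltree X -> Prop;
  hclassP : in_H hclass }.

Lemma H_nonempty (c : H_carrier) : exists T, hclass c T.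
Proof. by case: (hclassP c) => T ->; exists (hat T); apply: iso_refl. Qed.

(* A representative of the class; the operations of H(X) do not depend on
   which one is chosen. *)
Definition hrepr (c : H_carrier) : ltree X :=
  sval (constructive_indefinite_description _ (H_nonempty c)).

Definition hat_class (T : ltree X) : H_carrier :=
  HElt (ex_intro (fun S => tclass (hat T) = tclass (hat S)) T erefl).

Lemma in_H_eps : in_H (tclass eps).
Proof. by exists eps; apply/tclass_eq/hat_eps. Qed.

Lemma in_H_single (x : X) : in_H (tclass (single x)).
Proof. by exists (single x); apply/tclass_eq/hat_single. Qed.

Definition H : alg210 := @Alg210 H_carrier
  (fun c d => hat_class (glue (hrepr c) (hrepr d)))
  (fun c => hat_class (plus (hrepr c)))
  (HElt in_H_eps).

Definition H_gen (x : X) : H := HElt (in_H_single x).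

End HX.

(* Main.v *)
(** A tree is described by its trunk word x_1 ... x_k together with, for each
    trunk vertex, the finite prefix-closed language of labels of the directed
    paths leaving it.  This profile is invariant under splaying and pruning, and
    it is multiplicative.  Conversely a splayed tree maps to every tree whose
    profile dominates its own, and pruned trees that map to one another are
    isomorphic; so H(X) embeds into the algebra of profiles, where the axioms
    are easily checked.  A profile (L_0, (x_1, L_1), ..., (x_k, L_k)) takes the
    value e(L_0) chi(x_1) e(L_1) ... chi(x_k) e(L_k) in M, where e(L) is the
    product of the idempotents chi(w)^+ for w in L; the left h condition makes
    this a morphism. *)

Require Import Defs.
From mathcomp Require Import all_boot zify.
From Stdlib Require Import Classical ClassicalEpsilon FunctionalExtensionality
  PropExtensionality.

Set Implicit Arguments.
Unset Strict Implicit.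
Unset Printing Implicit Defensive.

(** * Trunk words decorated with languages *)

Section Profiles.
Variable X : Type.
Implicit Types (x : X) (w : seq X).

(** Products in [H X] are computed from trees picked by choice and specified only up to isomorphism,
    so a direct check of an axiom would carry isomorphisms through splaying and pruning. Profiles
    are compared by equality, and equal profiles already force isomorphic hats ([hat_iso]). A
    language does not record whether two paths of a branch share their first edges: splaying erases
    this from the tree, and in [M] the left h condition erases it, by turning the plus of a branch
    into a product of pluses of paths. The algebra [profiles] is itself no monoid, since [pone] is
    neutral only on suitable profiles, hence [wf]. Uniqueness of the extension comes from evaluating
    inside [profiles]: at the generators a well-formed profile evaluates to itself, so every element
    of [H X] is the value of its own profile. *)

Definition lang := seq X -> Prop.
Implicit Types (L : lang) (s : seq (X * lang)) (k : lang * seq (X * lang)).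

Definition lunion L L' : lang := fun w => L w \/ L' w.
Definition lcons x L : lang := fun w => exists2 v, L v & w = x :: v.
Definition lnil : lang := fun w => w = [::].

Lemma langP L L' : (forall w, L w <-> L' w) -> L = L'.
Proof.
move=> h; apply: functional_extensionality => w.
exact: propositional_extensionality.
Qed.

Lemma lunionC L L' : lunion L L' = lunion L' L.
Proof. by apply: langP => w; rewrite /lunion; tauto. Qed.

Lemma lunionA L L' L'' : lunion L (lunion L' L'') = lunion (lunion L L') L''.
Proof. by apply: langP => w; rewrite /lunion; tauto. Qed.

Lemma lunion_idr L L' : (forall w, L' w -> L w) -> lunion L L' = L.
Proof. by move=> h; apply: langP => w; split=> [[|/h]|] //; left. Qed.

Lemma lcons_union x L L' :
  lcons x (lunion L L') = lunion (lcons x L) (lcons x L').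
Proof.
apply: langP => w; split=> [[v [h|h] ->]|[] [v h ->]].
- by left; exists v.
- by right; exists v.
- by exists v => //; left.
- by exists v => //; right.
Qed.

(* Since [lcons x L1] is included in [L] for the profile of a tree, replacing it
   by [lcons x r.1] adds exactly the paths that run into the right factor. *)
Fixpoint pmul_rec L s k : lang * seq (X * lang) :=
  if s is (x, L1) :: s' then
    let r := pmul_rec L1 s' k in (lunion L (lcons x r.1), (x, r.1) :: r.2)
  else (lunion L k.1, k.2).

Definition pmul k k' := pmul_rec k.1 k.2 k'.
Definition pplus k : lang * seq (X * lang) := (k.1, [::]).
Definition pone : lang * seq (X * lang) := (lnil, [::]).

Definition profiles : alg210 := Alg210 pmul pplus pone.

Definition lang_fin L := exists l, forall w, L w <-> List.In w l.

Definition lang_ok L : Prop :=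
  [/\ L [::], forall w w', L (w ++ w') -> L w & lang_fin L].

(** In a tree, a path leaving a trunk vertex may begin with the next trunk edge, whence the
    inclusion. It makes [pone] right neutral and lets the plus of a value depend on the first
    language only. *)
Fixpoint wf_rec L s : Prop :=
  lang_ok L /\
  if s is (x, L1) :: s' then (forall w, L1 w -> L (x :: w)) /\ wf_rec L1 s'
  else True.

Definition wf k := wf_rec k.1 k.2.

Lemma wf_ok L s : wf_rec L s -> lang_ok L.
Proof. by case: s => [|[x L1] s] []. Qed.

Lemma pmul_sub L s k w : L w -> (pmul_rec L s k).1 w.
Proof. by case: s => [|[x L1] s] /=; left. Qed.

Lemma pmul_union L L' s k :
  pmul_rec (lunion L L') s k =
  (lunion L (pmul_rec L' s k).1, (pmul_rec L' s k).2).
Proof. by case: s => [|[x L1] s] /=; rewrite lunionA. Qed.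

Lemma pmulA k k' k'' : pmul k (pmul k' k'') = pmul (pmul k k') k''.
Proof.
case: k => L s; rewrite /pmul /=.
elim: s L => [|[x L1] s IH] L /=; first by rewrite pmul_union.
(* The paths through [x] present after multiplying by [k'] are still present after multiplying by
   [k''], so their set is absorbed. *)
rewrite IH -lunionA; congr (lunion L _, _); symmetry.
rewrite lunionC lunion_idr // => w [v h ->].
by exists v => //; apply: pmul_sub.
Qed.

(** Only the first language of [k] reaches back into the left factor; its trunk is appended
    unchanged. Cancelling this common suffix yields the cancellation law of left adequacy. *)
Lemma pmul_split L s k :
  pmul_rec L s k =
  ((pmul_rec L s (pplus k)).1, (pmul_rec L s (pplus k)).2 ++ k.2).
Proof. by elim: s L => [|[x L1] s IH] L //=; rewrite IH. Qed.

Lemma size_pmul L s k : size (pmul_rec L s k).2 = size s + size k.2.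
Proof. by elim: s L => [|[x L1] s IH] L //=; rewrite IH. Qed.

(** Both [k'] and [k] hang at the end of the same trunk, and prefixing a letter commutes with
    union. *)
Lemma pmul_left_h L s k k' :
  (pmul (pmul_rec L s (pplus k')) k).1 =
  lunion (pmul_rec L s k).1 (pmul_rec L s k').1.
Proof.
rewrite /pmul; elim: s L => [|[x L1] s IH] L /=.
  by apply: langP => w; rewrite /lunion; tauto.
rewrite IH (pmul_split L1 s k') /= lcons_union.
by apply: langP => w; rewrite /lunion; tauto.
Qed.

Lemma pmul1 k : wf k -> pmul k pone = k.
Proof.
case: k => L s; rewrite /wf /pmul /=; elim: s L => [|[x L1] s IH] L /=.
  by case=> -[L0 _ _] _; rewrite lunion_idr // => w ->.
case=> [okL [hL /IH ->]] /=; rewrite lunion_idr // => w [v hv ->]; exact: hL.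
Qed.

Lemma mul1p k : wf k -> pmul pone k = k.
Proof.
case: k => L s /wf_ok [L0 _ _]; rewrite /pmul /= lunionC lunion_idr //.
by move=> w ->.
Qed.

Lemma profiles_left_h_adequate (A : alg210) (f : A -> profiles) :
  morphism210 f -> injective f -> (forall a, wf (f a)) ->
  left_h_adequate_monoid A.
Proof.
case=> fM fP f1 fI fW; split.
- split=> [a b c|a|a]; apply: fI; rewrite !fM ?f1; first exact: pmulA.
    by apply: mul1p.
  by apply: pmul1.
- split; first split.
  + move=> a; apply: fI; rewrite fM fP; case: (f a) => L s.
    rewrite /= /pmul /=; congr pair; exact: lunion_idr.
  + by move=> a b; apply: fI; rewrite !(fP, fM).
  + by move=> a b; apply: fI; rewrite !fM !fP; congr pair; apply: lunionC.
  + move=> a b; apply: fI; rewrite !fP !fM fP; congr pair.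
    by rewrite /= /pmul pmul_split.
  + move=> a h; apply: fI; move: (congr1 f h); rewrite fM fP.
    (* Trunk lengths add up under multiplication, so an idempotent has an empty trunk. *)
    case: (f a) => L s e; have := congr1 (fun k => size k.2) e.
    rewrite /= /pmul size_pmul /= -{3}[size s]addn0 => /addnI/size0nil s0.
    by rewrite s0.
  + move=> a b c h; apply: fI; move: (congr1 f h); rewrite !fM !fP.
    rewrite /= /pmul (pmul_split (f a).1) (pmul_split (f b).1) => -[h1 h2].
    have /= h3 := List.app_inv_tail _ _ _ h2.
    by rewrite (surjective_pairing (pmul_rec (f a).1 _ _)) h1 h3
      -surjective_pairing.
- move=> a b c; apply: fI; rewrite !(fP, fM); congr pair.
  exact: pmul_left_h.
Qed.

Lemma lang_fin_union L L' : lang_fin L -> lang_fin L' -> lang_fin (lunion L L').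
Proof.
move=> [l hl] [l' hl']; exists (l ++ l') => w.
by rewrite /lunion hl hl'; split=> /List.in_app_iff.
Qed.

Lemma lang_fin_cons x L : lang_fin L -> lang_fin (lcons x L).
Proof.
move=> [l hl]; exists (map (cons x) l) => w.
split=> [[v /hl h ->]|/List.in_map_iff[v [<- /hl h]]]; last by exists v.
exact: List.in_map.
Qed.

Lemma lang_ok_union L L' : lang_ok L -> lang_ok L' -> lang_ok (lunion L L').
Proof.
move=> [a b c] [a' b' c']; split; first by left.
  by move=> w w' [/b|/b']; [left|right].
exact: lang_fin_union.
Qed.

Lemma lang_ok_cons x L L' :
  lang_ok L -> lang_ok L' -> lang_ok (lunion L (lcons x L')).
Proof.
move=> [a b c] [a' b' c']; split; first by left.
  move=> w w' [/b|[v hv]]; first by left.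
  case: w => [_|y w /= [-> e]]; first by left.
  by right; exists w => //; apply: (b' _ w'); rewrite e.
by apply: lang_fin_union => //; apply: lang_fin_cons.
Qed.

Lemma wf_mul k k' : wf k -> wf k' -> wf (pmul k k').
Proof.
case: k => L s; rewrite /wf /pmul /=.
elim: s L => [|[x L1] s IH] L /=.
  case: k' => L' [|[x L1] s] [okL _] /= [okL' h]; split=> //;
    try exact: lang_ok_union.
  by case: h => h1 h2; split=> // w /h1; right.
move=> [okL [h /IH{}IH]] /IH{}IH; split.
  by apply: lang_ok_cons => //; exact: (wf_ok IH).
by split=> // w hw; right; exists w.
Qed.

(** * Evaluation of profiles *)

Section Value.
Variables (M : alg210) (chi : X -> M).

Definition vword w : M := foldr (fun x => amul (chi x)) aone w.
Definition vwords l : M := foldr (fun w => amul (aplus (vword w))) aone l.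
(* Unspecified when [L] is infinite. *)
Definition words L : seq (seq X) :=
  epsilon (inhabits [::]) (fun l => forall w, L w <-> List.In w l).
Definition vlang L : M := vwords (words L).
Fixpoint vrec L s : M :=
  if s is (x, L1) :: s' then amul (vlang L) (amul (chi x) (vrec L1 s'))
  else vlang L.
Definition value k : M := vrec k.1 k.2.

Lemma wordsP L : lang_fin L -> forall w, L w <-> List.In w (words L).
Proof. exact: (epsilon_spec _ (fun l => forall w, L w <-> List.In w l)). Qed.

Hypothesis hM : left_h_adequate_monoid M.

Let mA : associative (@amul M). Proof. by case: hM => -[]. Qed.
Let m1l : left_id aone (@amul M). Proof. by case: hM => -[]. Qed.
Let m1r : right_id aone (@amul M). Proof. by case: hM => -[]. Qed.
Let pM (a : M) : amul (aplus a) a = a. Proof. by case: hM => _ [[]]. Qed.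
Let ppM (a b : M) :
  aplus (amul (aplus a) (aplus b)) = amul (aplus a) (aplus b).
Proof. by case: hM => _ [[]]. Qed.
Let pC (a b : M) : amul (aplus a) (aplus b) = amul (aplus b) (aplus a).
Proof. by case: hM => _ [[]]. Qed.
Let pMp (a b : M) : aplus (amul a b) = aplus (amul a (aplus b)).
Proof. by case: hM => _ [[]]. Qed.
Let hH (a b c : M) : aplus (amul (amul a (aplus c)) b) =
  amul (aplus (amul a b)) (aplus (amul a c)).
Proof. by case: hM. Qed.
Let p1 : aplus (@aone M) = aone. Proof. by rewrite -[LHS]m1r pM. Qed.
Let pid (a : M) : amul (aplus a) (aplus a) = aplus a.
Proof. by rewrite -ppM -pMp pM. Qed.

Lemma vwords_plus l : aplus (vwords l) = vwords l.
Proof. by elim: l => [|w l IH] /=; rewrite ?p1 // -IH ppM. Qed.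

Lemma vlang_plus L : aplus (vlang L) = vlang L.
Proof. exact: vwords_plus. Qed.

Lemma vwords_in w l :
  List.In w l -> amul (aplus (vword w)) (vwords l) = vwords l.
Proof.
elim: l => //= v l IH [->|/IH {}IH]; first by rewrite mA pid.
by rewrite mA pC -mA IH.
Qed.

Lemma vwords_sub l l' : (forall w, List.In w l -> List.In w l') ->
  amul (vwords l) (vwords l') = vwords l'.
Proof.
elim: l => [|w l IH] h /=; first exact: m1l.
rewrite -mA IH => [|v hv]; last by apply: h; right.
by apply: vwords_in; apply: h; left.
Qed.

Lemma vwordsC l l' : amul (vwords l) (vwords l') = amul (vwords l') (vwords l).
Proof. by rewrite -(vwords_plus l) -(vwords_plus l') pC. Qed.

(** The factors are commuting idempotents, so order and repetitions are irrelevant; this makes the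
    list chosen by [words] harmless. *)
Lemma vwords_eq l l' :
  (forall w, List.In w l <-> List.In w l') -> vwords l = vwords l'.
Proof.
move=> h; rewrite -[RHS](@vwords_sub l) => [|w]; last by rewrite h.
by rewrite vwordsC vwords_sub // => w; rewrite h.
Qed.

Lemma vwords_cat l l' : vwords (l ++ l') = amul (vwords l) (vwords l').
Proof. by elim: l => [|w l IH] /=; rewrite ?m1l // IH mA. Qed.

Lemma vlangE L l : (forall w, L w <-> List.In w l) -> vlang L = vwords l.
Proof.
move=> h; apply: vwords_eq => w; rewrite -h -wordsP //; by exists l.
Qed.

Lemma vlang_union L L' : lang_fin L -> lang_fin L' ->
  vlang (lunion L L') = amul (vlang L) (vlang L').
Proof.
move=> hL hL'; have fL := wordsP hL; have fL' := wordsP hL'.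
rewrite -vwords_cat; apply: vlangE => w.
by rewrite /lunion fL fL'; split=> /List.in_app_iff.
Qed.

(** The left h condition enters the evaluation here: it splits off one path at a time. *)
Lemma vwords_cons x l : aplus (amul (chi x) (vwords l)) =
  amul (aplus (chi x)) (vwords (map (cons x) l)).
Proof.
elim: l => [|w l IH] /=; first by rewrite !m1r.
rewrite mA hH IH -mA; congr amul.
by rewrite -vwords_plus pC.
Qed.

(** Since [L] contains the empty word, the leftover factor [aplus (chi x)] belongs to the word
    [[:: x]] and is absorbed. *)
Lemma vlang_cons x L : L [::] -> lang_fin L ->
  aplus (amul (chi x) (vlang L)) = vlang (lcons x L).
Proof.
move=> L0 hL; have fL := wordsP hL; rewrite vwords_cons -(@vlangE (lcons x L)).
  have h : lcons x L [:: x] by exists [::].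
  have -> : chi x = vword [:: x] by rewrite /= m1r.
  rewrite vwords_in // -wordsP //; apply: lang_fin_cons; by exists (words L).
move=> w; split=> [[v /fL h ->]|/List.in_map_iff[v [<- /fL h]]].
  exact: List.in_map.
by exists v.
Qed.

Lemma vrec_plus L s : wf_rec L s -> aplus (vrec L s) = vlang L.
Proof.
elim: s L => [|[x L1] s IH] L /=; first by move=> _; apply: vlang_plus.
case=> -[L0 _ fL] [h w1]; have [L10 _ fL1] := wf_ok w1.
rewrite pMp (pMp (chi x)) (IH _ w1) vlang_cons //.
rewrite -(vlang_plus L) -(vlang_plus (lcons x L1)) ppM !vlang_plus.
rewrite -vlang_union //; last exact: lang_fin_cons.
by rewrite lunion_idr // => w [v hv ->]; apply: h.
Qed.

Lemma value_plus k : wf k -> value (pplus k) = aplus (value k).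
Proof. by move=> h; rewrite /value vrec_plus. Qed.

Lemma value_mul k k' : wf k -> wf k' ->
  value (pmul k k') = amul (value k) (value k').
Proof.
case: k => L s; case: k' => L' s' ; rewrite /value /wf /pmul /= => wk wk'.
have [L'0 _ fL'] := wf_ok wk'.
elim: s L wk => [|[x L1] s IH] L /= [[L0 _ fL] w1].
  case: s' {w1} wk' => [|[x L1] s'] wk' /=; first exact: vlang_union.
  by rewrite vlang_union // mA.
case: w1 => h w1; have wr := @wf_mul (L1, s) (L', s') w1 wk'.
rewrite -mA -mA -IH // vlang_union //; last first.
  by apply: lang_fin_cons; case: (wf_ok wr).
have [r0 _ fr] := wf_ok wr.
(* The language inserted by [pmul_rec] evaluates to the plus of the element that follows it, and a
   plus is absorbed by its own element. *)
rewrite -mA; congr amul; rewrite -vlang_cons // -(vrec_plus wr) -pMp.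
exact: pM.
Qed.

Lemma value_one : value pone = aone.
Proof.
rewrite /value /= (@vlangE _ [:: [::]]) /= ?p1 ?m1l // => w.
by split=> [->|[<-|[]]]; [left|].
Qed.

Definition psingle x : lang * seq (X * lang) :=
  (lunion lnil (lcons x lnil), [:: (x, lnil)]).

Lemma value_single x : value (psingle x) = chi x.
Proof.
rewrite /value /= (@vlangE lnil [:: [::]]) /=; last first.
  by move=> w; split=> [->|[<-|[]]]; [left|].
rewrite (@vlangE _ [:: [::]; [:: x]]) /=; last first.
  move=> w; split=> [[->|[v -> ->]]|[<-|[<-|[]]]];
    [by left|by right; left|by left|].
  by right; exists [::].
by rewrite p1 !m1r m1l pM.
Qed.

End Value.

(** Both sides multiply along the same list [words L], so no axiom on [M] or [N] is required; this
    permits [N] to be [profiles]. *)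
Lemma morphism_value (M N : alg210) (chi : X -> M) (f : M -> N) k :
  morphism210 f -> f (value chi k) = value (f \o chi) k.
Proof.
case: k => L s [fM fP f1].
have fw w : f (vword chi w) = vword (f \o chi) w.
  by elim: w => //= x w IH; rewrite fM IH.
have fl L' : f (vlang chi L') = vlang (f \o chi) L'.
  by rewrite /vlang; elim: (words L') => //= w l IH; rewrite fM fP fw IH.
by rewrite /value /=; elim: s L => //= -[x L1] s IH L; rewrite !fM fl IH.
Qed.

Lemma vword_psingle w v :
  (vword (M := profiles) psingle w).1 v <-> exists u, w = v ++ u.
Proof.
elim: w v => [|x w IH] v /=.
  by split=> [->|[u]]; [exists [::] | case: v].
have e1 : (pmul (psingle x) (vword (M := profiles) psingle w)).1 =
  lunion lnil (lcons x (vword (M := profiles) psingle w).1).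
  rewrite /pmul /=; apply: langP => u; split.
    case=> [[->|[t -> ->]]|[t [->|h] ->]]; first by left.
    - by right; exists [::] => //; apply/IH; exists w.
    - by right; exists [::] => //; apply/IH; exists w.
    - by right; exists t.
  case=> [->|[t h ->]]; first by left; left.
  by right; exists t => //; right.
rewrite [X in X v]e1; split=> [[->|[t /IH[u ->] ->]]|[u]].
- by exists (x :: w).
- by exists u.
case: v => [|y v] /=; first by left.
by case=> -> e; right; exists v => //; apply/IH; exists u.
Qed.

(** The plus of a word is the set of its prefixes, so a prefix-closed [L] evaluates to itself; the
    words added by the trunk edges lie in [L] by the inclusion in [wf]. *)
Lemma value_profiles k : wf k -> value (M := profiles) psingle k = k.
Proof.
have hl L : lang_ok L -> vlang (M := profiles) psingle L = (L, [::]).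
  move=> [L0 Lp hL]; have fL := wordsP hL; rewrite /vlang.
  have -> : vwords (M := profiles) psingle (words L) = ((fun v => v = [::] \/
      exists2 w, List.In w (words L) & exists u, w = v ++ u), [::]).
    elim: (words L) => [|w l IH] /=.
      by congr pair; apply: langP => v; split=> [->|[//|[]//]]; left.
    rewrite IH /pmul /=; congr pair; apply: langP => v; split.
      case=> [/vword_psingle[u e]|[->|[t h1 h2]]]; [|by left|].
        by right; exists w; [left|exists u].
      by right; exists t; [right|].
    case=> [->|[t [<-|h] [u e]]]; first by right; left.
      by left; apply/vword_psingle; exists u.
    by right; right; exists t => //; exists u.
  congr pair; apply: langP => v; split.
    by case=> [->//|[w /fL h [u e]]]; apply: (Lp v u); rewrite -e.
  by move=> /fL h; right; exists v => //; exists [::]; rewrite cats0.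
case: k => L s; rewrite /wf /value /=.
elim: s L => [|[x L1] s IH] L /=; first by case=> /hl ->.
case=> okL [h w1]; rewrite (IH _ w1) hl //.
have [L10 _ _] := wf_ok w1.
have e0 : lunion lnil L1 = L1 by rewrite lunionC lunion_idr // => u ->.
rewrite /pmul /= /pmul /= e0; congr pair.
apply: langP => w; split; last by left.
by case=> // -[[->|[t -> ->]]|[t ht ->]]; [case: okL|apply: h|apply: h].
Qed.

End Profiles.

(** * Walks in trees *)

Lemma not_uniq_map_split (T : Type) (U : eqType) (f : T -> U) (s : seq T) :
  ~~ uniq (map f s) ->
  exists s1 a s2 b s3, s = s1 ++ a :: s2 ++ b :: s3 /\ f a = f b.
Proof.
elim: s => //= a s IH; rewrite negb_and negbK => /orP[h|/IH]; last first.
  by case=> s1 [b [s2 [c [s3 [-> e]]]]]; exists (a :: s1), b, s2, c, s3.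
suff [s2 [b [s3 [-> e]]]] : exists s2 b s3, s = s2 ++ b :: s3 /\ f a = f b.
  by exists [::], a, s2, b, s3.
elim: s h {IH} => //= b s IH; rewrite inE => /orP[/eqP e|/IH].
  by exists [::], b, s.
by case=> s2 [c [s3 [-> e]]]; exists (b :: s2), c, s3.
Qed.

Section UniqueWalks.
Variables (X : Type) (G : lgraph X).
Implicit Types (u v : vertex G) (e : edge G).

Definition no_backtrack (d d' : dart G) : bool := d' != (d.1, ~~ d.2).

Hypothesis acG : uacyclic G.

(** Strong induction on length: a repeated vertex cuts out a shorter closed reduced walk. If neither
    vertices nor edges repeat, the walk is a cycle. *)
Lemma closed_reduced_walk u (p : seq (dart G)) :
  uwalk u p u -> sorted no_backtrack p -> p = [::].
Proof.
have [n] := ubnP (size p); elim: n => // n IH in u p *.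
rewrite ltnS => ltn hw sp.
have inner v p1 q p2 : p = p1 ++ q ++ p2 -> size q < size p -> uwalk v q v ->
    q = [::].
  move=> ep lq wq; apply: (IH v) => //; first exact: leq_trans lq ltn.
  by move: sp; rewrite ep => /cat_sorted2[_ /cat_sorted2[]].
apply/eqP/negPn/negP => /eqP np.
have [us|/not_uniq_map_split] := boolP (uniq [seq dsource d | d <- p]);
  last first.
  case=> p1 [a [p2 [b [p3 [ep ab]]]]].
  have := inner (dsource a) p1 (a :: p2) (b :: p3).
  rewrite ep /= => h; suff: a :: p2 = [::] by [].
  apply: h => //.
    by rewrite !size_cat /= !size_cat /=; lia.
  rewrite eqxx /=; move: hw; rewrite ep => /uwalk_cat[v [_ /=]] /andP[_].
  by case/uwalk_cat=> w [h1 /= /andP[/eqP h2 _]]; rewrite ab h2.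
have [ue|/not_uniq_map_split] := boolP (uniq [seq d.1 | d <- p]).
  by have /negP[] := acG u p; apply/and4P; split=> //; apply/eqP.
case=> p1 [a [p2 [b [p3 [ep ab]]]]].
(* Traversing the edge twice in the same direction would repeat its source, and sources are distinct
   here. *)
have nab : a.2 != b.2.
  apply/eqP => ab2; have e : a = b.
    by case: a b ab ab2 {ep} => ? ? [? ?] /= -> ->.
  move: us; rewrite ep e map_cat cat_uniq /= map_cat mem_cat /= inE eqxx.
  by rewrite orbT /= !andbF.
have eb : b = (a.1, ~~ a.2).
  by case: a b ab nab {ep} => a1 [] [b1 []] /= ->.
(* The walk between the two opposite traversals is closed and shorter, hence empty, and the
   traversals form a backtrack. *)
have p20 : p2 = [::].
  apply: (inner (dtarget a) (rcons p1 a) p2 (b :: p3)).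
  - by rewrite ep cat_rcons.
  - by rewrite ep !size_cat /= !size_cat /=; lia.
  move: hw; rewrite ep => /uwalk_cat[v [_ /=]] /andP[_].
  case/uwalk_cat=> w [h1 /= /andP[/eqP h2 _]].
  by move: h1; rewrite -h2 eb /dsource /dtarget /=; case: (a.2).
move: sp; rewrite ep p20 /= => /cat_sorted2[_ /=]; rewrite {1}/no_backtrack.
by rewrite eb eqxx.
Qed.

Lemma sorted_forward (p : seq (edge G)) b :
  sorted no_backtrack [seq (e, b) | e <- p].
Proof.
case: p => //= e p; elim: p e => //= f p IH e; rewrite IH andbT.
by rewrite /no_backtrack /= xpair_eqE; case: b {IH}; rewrite andbF.
Qed.

Lemma dwalk_rcons u p e v :
  dwalk u (rcons p e) v <-> dwalk u p (source e) /\ target e = v.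
Proof.
rewrite -cats1; split=> [/dwalk_cat[w [h /= /andP[/eqP-> /eqP->]]]//|[h <-]].
by apply/dwalk_cat; exists (source e); rewrite /= !eqxx.
Qed.

Lemma dwalk_backward u p v :
  dwalk u p v -> uwalk v [seq (e, false) | e <- rev p] u.
Proof.
elim/last_ind: p v => [|p e IH] v /= => [/eqP->//|/dwalk_rcons[/IH h <-]].
by rewrite rev_rcons /= /dsource /dtarget /= eqxx.
Qed.

(** Strip common last edges. Once the last edges differ, [p] followed by the reverse of [q] is
    closed and has no backtrack at the turning point. *)
Lemma dwalk_unique u p q v : dwalk u p v -> dwalk u q v -> p = q.
Proof.
have closed (w : vertex G) r : dwalk w r w -> r = [::].
  move/dwalk_uwalk => h; have := closed_reduced_walk h (sorted_forward _ _).
  by case: r {h}.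
elim/last_ind: p q v => [|p a IH] q v hp hq.
  by move: hp => /= /eqP e; move: hq; rewrite e => /closed.
case/lastP: q hq => [|q b] hq.
  by move: hq => /= /eqP e; move: hp; rewrite e => /closed.
have [/eqP ab|nab] := boolP (a == b).
  move: hp hq; rewrite ab => /dwalk_rcons[hp _] /dwalk_rcons[hq _].
  by rewrite (IH _ _ hp hq).
have := closed_reduced_walk (u := u)
  (p := [seq (e, true) | e <- rcons p a] ++
    [seq (e, false) | e <- rev (rcons q b)]).
move=> H; suff : false by [].
suff: [seq (e, true) | e <- rcons p a] ++
  [seq (e, false) | e <- rev (rcons q b)] = [::] by case: (p).
apply: H.
  by apply/uwalk_cat; exists v; split;
    [apply: dwalk_uwalk|apply: dwalk_backward].
have := sorted_forward (rcons p a) true.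
have := sorted_forward (rev (rcons q b)) false.
rewrite rev_rcons map_rcons /= cat_rcons.
move: [seq _ | e <- p] [seq _ | e <- rev q] => s t h1 h2.
have h : no_backtrack (a, true) (b, false).
  by rewrite /no_backtrack xpair_eqE /= andbT eq_sym.
case: s h2 => [|c s] /=; first by rewrite h.
by rewrite -cats1 !cat_path /= h => /andP[-> /andP[-> _]].
Qed.

End UniqueWalks.

Section TreeWalks.
Variables (X : Type) (T : ltree X).
Implicit Types (u v : vertex T) (e f : edge T).

Lemma ltree_acyclic : uacyclic T.
Proof. by case: (ltree_tree T). Qed.

Lemma path_toP v : dwalk (start T) (path_to v) v.
Proof. exact: (xchooseP (ltree_reachable v)). Qed.

Lemma path_toE v p : dwalk (start T) p v -> p = path_to v.
Proof. by move=> h; apply: (dwalk_unique ltree_acyclic h); apply: path_toP. Qed.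

Lemma path_to_target e : path_to (target e) = rcons (path_to (source e)) e.
Proof.
by symmetry; apply: path_toE; apply/dwalk_rcons; split=> //; apply: path_toP.
Qed.

Lemma path_to_start : path_to (start T) = [::].
Proof. by symmetry; apply: path_toE => /=. Qed.

Lemma target_inj : injective (@target X T).
Proof.
move=> e f h; have := path_to_target e; rewrite h path_to_target.
by case/rcons_inj.
Qed.

Lemma target_start e : target e != start T.
Proof.
apply/eqP => h; have := path_to_target e; rewrite h path_to_start.
by case: (path_to _).
Qed.

Lemma vertex_ind (P : vertex T -> Prop) :
  P (start T) -> (forall e, P (source e) -> P (target e)) -> forall v, P v.
Proof.
move=> P0 PS v; move: (path_toP v); move: (path_to v) => p.
elim/last_ind: p v => [v /= /eqP<- //|p e IH v].
by case/dwalk_rcons=> /IH h <-; apply: PS.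
Qed.

(** Depth is bounded and grows along edges. Hence every path is a prefix of a path to a leaf, which
    is why splaying loses no label word. *)
Lemma dwalk_to_leaf u : exists2 v, is_leaf v & exists p, dwalk u p v.
Proof.
have [n] := ubnP (\max_(v : vertex T) size (path_to v) - size (path_to u)).
elim: n => // n IH in u *; rewrite ltnS => hn.
have [hl|] := boolP (is_leaf u); first by exists u => //; exists [::] => /=.
rewrite negb_forall => /existsP[e]; rewrite negbK => /eqP se.
have [|v hv [p hp]] := IH (target e); last first.
  by exists v => //; exists (e :: p); rewrite /= se eqxx.
apply: leq_trans hn; rewrite path_to_target size_rcons se subnS prednK //.
rewrite subn_gt0 -se; apply: leq_trans (leq_bigmax (target e)).
by rewrite path_to_target size_rcons.
Qed.

End TreeWalks.

(** * Profiles of trees *)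

Section GraphProfile.
Variables (X : Type) (G : lgraph X).
Implicit Types (u v : vertex G) (e : edge G).

Definition glang u : lang X :=
  fun w => exists v p, dwalk u p v /\ [seq label e | e <- p] = w.

(** Defined along an arbitrary walk, so that a target graph can be cut at any vertex while a
    morphism is assembled factor by factor. *)
Definition gprofile u (p : seq (edge G)) : profiles X :=
  (glang u, [seq (label e, glang (target e)) | e <- p]).

Lemma glang_nil u : glang u [::].
Proof. by exists u, [::]; split=> /=. Qed.

Lemma glang_cons e w : glang (target e) w -> glang (source e) (label e :: w).
Proof. by case=> v [p [h <-]]; exists v, (e :: p); rewrite /= eqxx. Qed.

Lemma glang_prefix u w w' : glang u (w ++ w') -> glang u w.
Proof.
case=> v [p [h e]]; have := h; rewrite -(cat_take_drop (size w) p).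
case/dwalk_cat=> z [h1 _]; exists z, (take (size w) p); split=> //.
by rewrite map_take e take_size_cat.
Qed.

End GraphProfile.

Lemma lang_fin_image (X : Type) (I : finType) (P : pred I) (F : I -> seq X) :
  lang_fin (fun w => exists2 i, P i & w = F i).
Proof.
exists [seq F i | i <- enum P] => w; split=> [[i Pi ->]|].
  have : i \in enum P by rewrite mem_enum.
  elim: (enum P) => //= j s IH; rewrite inE => /orP[/eqP->|/IH]; first by left.
  by right.
have : forall i, i \in enum P -> P i by move=> i; rewrite mem_enum.
elim: (enum P) => //= j s IH h [<-|/IH h'].
  by exists j; rewrite ?h ?mem_head.
by apply: h' => i hi; apply: h; rewrite inE hi orbT.
Qed.

Section TreeProfile.
Variables (X : Type) (T : ltree X).
Implicit Types (u v : vertex T) (e : edge T).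

(** A walk from [u] is determined by its end [v]: it is [path_to v] with the prefix [path_to u]
    removed. *)
Lemma glang_fin u : lang_fin (glang u).
Proof.
pose q v := drop (size (path_to u)) (path_to v).
have [l hl] := lang_fin_image (fun v => dwalk u (q v) v)
  (fun v => [seq label e | e <- q v]).
exists l => w; rewrite -hl; split=> [[v [p [h <-]]]|[v h ->]].
  have e : path_to v = path_to u ++ p.
    by symmetry; apply: path_toE; apply/dwalk_cat; exists u; split=> //;
      apply: path_toP.
  by exists v; rewrite /q e drop_size_cat.
by exists v, (q v).
Qed.

Lemma glang_ok u : lang_ok (glang u).
Proof. by split; [apply: glang_nil|apply: glang_prefix|apply: glang_fin]. Qed.

Lemma gprofile_wf u p v : dwalk u p v -> wf (gprofile u p).
Proof.
rewrite /wf /=; elim: p u => [|e p IH] u /=.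
  by split=> //; apply: glang_ok.
case/andP=> /eqP <- /IH h; split; first exact: glang_ok.
by split=> // w; apply: glang_cons.
Qed.

Definition profile : profiles X := gprofile (start T) (path_to (stop T)).

Lemma profile_wf : wf profile.
Proof. exact: gprofile_wf (path_toP _). Qed.

Lemma profileE p :
  dwalk (start T) p (stop T) -> profile = gprofile (start T) p.
Proof. by move=> /path_toE ->. Qed.

End TreeProfile.

(** * Multiplicativity of profiles under gluing *)

Section GlueProfile.
Variables (X : Type) (S T : ltree X).
Let G := glue S T.

Lemma glue_inr_inj : injective (@glue_inr X S T).
Proof.
move=> u v; rewrite /glue_inr.
case: insubP => [a _ <-|/negbNE/eqP->];
  by case: insubP => [b _ <-|/negbNE/eqP->] // [->].
Qed.

(** No edge of [T] enters its start vertex, so a walk that has left the gluing point into [T] never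
    returns to it. *)
Lemma dwalk_glue_inr (v : vertex T) (p : seq (edge G)) (z : vertex G) :
  v != start T -> dwalk (glue_inr S v : vertex G) p z ->
  exists q v', [/\ p = map inr q, z = glue_inr S v' & dwalk v q v'].
Proof.
elim: p v => [|[e|e] p IH] v nv /=.
- by move/eqP=> <-; exists [::], v; split=> /=.
- by rewrite /glue_inr insubT => /andP[/eqP].
case/andP=> /eqP/glue_inr_inj <- /(IH _ (target_start e))[q [v' [-> -> h]]].
by exists (e :: q), v'; split=> //=; rewrite eqxx.
Qed.

Lemma dwalk_glue_inl (u : vertex S) (p : seq (edge G)) (z : vertex G) :
  dwalk (inl u : vertex G) p z ->
  (exists q v', [/\ p = map inl q, z = inl v' & dwalk u q v']) \/
  exists q r v', [/\ p = map inl q ++ map inr r, z = glue_inr S v',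
    dwalk u q (stop S) & dwalk (start T) r v'].
Proof.
elim: p u => [|[e|e] p IH] u /=.
- by move/eqP=> <-; left; exists [::], u; split=> /=.
- case/andP=> /eqP[<-] /IH[[q [v' [-> -> h]]]|[q [r [v' [-> -> h h']]]]].
    by left; exists (e :: q), v'; split=> //=; rewrite eqxx.
  by right; exists (e :: q), r, v'; split=> //=; rewrite eqxx.
case/andP=> /eqP hs /(dwalk_glue_inr (target_start e))[q [v' [-> -> h]]].
right; exists [::], (e :: q), v'.
move: hs; rewrite /= /glue_inr; case: insubP => // /negbNE/eqP -> [<-].
by rewrite !eqxx.
Qed.

Lemma glang_glue_inr (v : vertex T) :
  v != start T -> glang (glue_inr S v : vertex G) = glang v.
Proof.
move=> nv; apply: langP => w; split=> [[z [p [/(dwalk_glue_inr nv)]]]|].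
  by case=> q [v' [-> _ h] <-]; exists v', q; split=> //; rewrite -map_comp.
case=> v' [q [/(dwalk_inr S) h <-]]; exists (glue_inr S v'), (map inr q).
by split=> //; rewrite -map_comp.
Qed.

Lemma glang_glue_inl (u : vertex S) p w : dwalk u p (stop S) ->
  glang (inl u : vertex G) w <-> glang u w \/
  exists2 w', glang (start T) w' & w = [seq label e | e <- p] ++ w'.
Proof.
move=> hp; split.
  case=> z [q [/dwalk_glue_inl hq <-]].
  case: hq => [[r [v' [-> _ h]]]|[r [r' [v' [-> _ h h']]]]].
    by left; exists v', r; split=> //; rewrite -map_comp.
  right; exists [seq label e | e <- r']; first by exists v', r'.
  by rewrite (dwalk_unique (@ltree_acyclic X S) h hp) map_cat -!map_comp.
case=> [[v [q [/(dwalk_inl T) h <-]]]|[w' [v [q [/(dwalk_inr S) h <-] ->]]]].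
  by exists (inl v), (map inl q); split=> //; rewrite -map_comp.
exists (glue_inr S v), (map inl p ++ map inr q); split.
  apply/dwalk_cat; exists (inl (stop S)); split; first exact: dwalk_inl.
  by rewrite -(glue_inr_start S T).
by rewrite map_cat -!map_comp.
Qed.

Lemma profile_glue : profile (glue S T) = amul (profile S) (profile T).
Proof.
set q := path_to (stop T).
have hq : dwalk (start T) q (stop T) by apply: path_toP.
have hp : dwalk (start S) (path_to (stop S)) (stop S) by apply: path_toP.
rewrite (profileE (T := glue S T)
  (p := map inl (path_to (stop S)) ++ map inr q)); last first.
  apply/dwalk_cat; exists (inl (stop S)); split; first exact: dwalk_inl.
  by rewrite -(glue_inr_start S T); apply: dwalk_inr.
rewrite /profile /= /pmul /= -/q /gprofile.
(* The induction removes trunk edges of [S] from the front, so the vertex at which the trunk starts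
   must vary. *)
move: (path_to (stop S)) hp => p.
elim: p (start S) => [|e p IH] u /=.
  move/eqP=> hu; congr pair.
    apply: langP => w; rewrite (@glang_glue_inl u [::]) /=; last by rewrite hu.
    by split=> [[|[w' h ->]]|[]]; [left|right|left|right; exists w].
  rewrite -map_comp; apply: eq_map => e /=.
  by rewrite glang_glue_inr ?target_start.
case/andP=> /eqP hu hp; rewrite -(IH _ hp) /=; congr pair.
apply: langP => w.
rewrite (@glang_glue_inl u (e :: p)) /= ?hu ?eqxx //; split.
  case=> [|[w' h ->]]; first by left.
  right; exists ([seq label e | e <- p] ++ w') => //.
  by apply/(glang_glue_inl _ hp); right; exists w'.
case=> [|[v]]; first by left.
case/(glang_glue_inl _ hp) => [h ->|[w' h ->] ->].
  by left; rewrite -hu; apply: glang_cons.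
by right; exists w'.
Qed.

End GlueProfile.

Section BasicProfiles.
Variable X : Type.

Lemma profile_plus (T : ltree X) : profile (plus T) = aplus (profile T).
Proof. by rewrite (profileE (T := plus T) (p := [::])) /=. Qed.

Lemma glang_edgeless (G : lgraph X) (u : vertex G) :
  (forall e, source e != u) -> glang u = @lnil X.
Proof.
move=> h; apply: langP => w; split=> [[v [[|e p] [/= hp <-]]]|->] //.
  by move: hp; rewrite (negbTE (h e)).
exact: glang_nil.
Qed.

Lemma profile_eps : profile (@eps X) = aone.
Proof.
by rewrite (profileE (T := eps) (p := [::])) // /gprofile glang_edgeless.
Qed.

Lemma profile_single (x : X) : profile (single x) = psingle x.
Proof.
rewrite (profileE (T := single x) (p := [:: tt])) // /gprofile /= /psingle.
have e1 : @glang X (single x) true = @lnil X by apply: glang_edgeless.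
rewrite e1; congr pair; apply: langP => w; split.
  case=> v [[|[] p] [/= hp <-]]; first by left.
  right; exists [seq label e | e <- p] => //; rewrite -e1.
  by exists v, p.
case=> [->|[v -> ->]]; first exact: glang_nil.
by exists true, [:: tt].
Qed.

Definition path_of (w : seq X) : ltree X := \big[@glue X/eps]_(x <- w) single x.

Lemma profile_path_of w :
  profile (path_of w) = vword (M := profiles X) (@psingle X) w.
Proof.
rewrite /path_of; elim: w => [|x w IH]; first by rewrite big_nil profile_eps.
by rewrite big_cons profile_glue IH profile_single.
Qed.

Definition word_to (B : ltree X) (v : vertex B) : seq X :=
  [seq label e | e <- path_to v].

Lemma path_treeE (B : ltree X) (v : vertex B) :
  path_tree v = plus (path_of (word_to v)).
Proof. by rewrite /path_tree /path_of big_map. Qed.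

Lemma profile_splay_branch (B : ltree X) :
  profile (splay_branch B) = (glang (start B), [::]).
Proof.
have -> : profile (splay_branch B) = ((fun w => w = [::] \/
    exists2 v : vertex B, is_leaf v & exists u, word_to v = w ++ u), [::]).
  rewrite /splay_branch -big_filter.
  have : forall v : vertex B,
    v \in [seq i <- index_enum (vertex B) | is_leaf i] <-> is_leaf v.
    by move=> v; rewrite mem_filter mem_index_enum andbT.
  move: [seq _ <- _ | _] => r hr.
  have -> : profile (\big[@glue X/eps]_(i <- r) path_tree i) =
    ((fun w => w = [::] \/
    exists2 v : vertex B, v \in r & exists u, word_to v = w ++ u), [::]).
    elim: {hr} r => [|v r IH].
      rewrite big_nil profile_eps; congr pair; apply: langP => w.
      by split=> [->|[->|[]]] //; left.
    rewrite big_cons profile_glue IH path_treeE profile_plus profile_path_of.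
    congr pair; apply: langP => w; split.
      case=> [/vword_psingle h|[->|[z h1 h2]]]; [|by left|].
        by right; exists v; rewrite ?mem_head.
      by right; exists z => //; rewrite inE h1 orbT.
    case=> [->|[z]]; first by right; left.
    rewrite inE => /orP[/eqP->|h1] h2; first by left; apply/vword_psingle.
    by right; right; exists z.
  by congr pair; apply: langP => w; split=> -[->|[v /hr h1 h2]];
    by [left|right; exists v].
congr pair; apply: langP => w; split.
  case=> [->|[v _ [u e]]]; first exact: glang_nil.
  apply: (@glang_prefix _ _ _ _ u); rewrite -e.
  by exists v, (path_to v); split=> //; apply: path_toP.
case=> v [p [hp <-]]; right; have [z hz [q hq]] := dwalk_to_leaf v.
exists z => //; exists [seq label e | e <- q].
rewrite -map_cat /word_to; congr map; symmetry; apply: path_toE.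
by apply/dwalk_cat; exists v.
Qed.

Lemma profile_in_E (B : ltree X) :
  in_E B -> profile B = (glang (start B), [::]).
Proof. by move/eqP=> h; rewrite (profileE (p := [::])) //= h. Qed.

Lemma profile_unbranch (B0 : ltree X) s :
  in_E B0 -> all (fun xB => in_E xB.2) s ->
  profile (unbranch (@splay_branch X) B0 s) = profile (unbranch id B0 s).
Proof.
move=> h0; rewrite /unbranch; elim/last_ind: s => [_|s [x B] IH].
  by rewrite /= profile_splay_branch profile_in_E.
rewrite all_rcons => /andP[hB /IH{}IH]; rewrite !foldl_rcons !profile_glue IH.
by rewrite profile_splay_branch (profile_in_E hB).
Qed.

End BasicProfiles.

(** * Comparing profiles by morphisms *)

Section Comparison.
Variable X : Type.
Implicit Types (s : seq (X * lang X)) (k : lang X * seq (X * lang X)).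

Definition lang_le (L L' : lang X) : Prop := forall w, L w -> L' w.

Fixpoint trunk_le s s' : Prop :=
  match s, s' with
  | [::], [::] => True
  | (x, L) :: s, (x', L') :: s' => [/\ x = x', lang_le L L' & trunk_le s s']
  | _, _ => False
  end.

Definition profile_le k k' : Prop := lang_le k.1 k'.1 /\ trunk_le k.2 k'.2.

Lemma profile_le_anti k k' : profile_le k k' -> profile_le k' k -> k = k'.
Proof.
have aL L L' : lang_le L L' -> lang_le L' L -> L = L'.
  by move=> h h'; apply: langP => w; split; [apply: h|apply: h'].
case: k k' => [L s] [L' s'] [h1 h2] [h1' h2']; congr pair; first exact: aL.
elim: s s' {h1 h1'} h2 h2' => [|[x L1] s IH] [|[x' L1'] s'] //=.
by case=> -> h1 h2 [_ h1' h2']; rewrite (aL L1 L1') // (IH s').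
Qed.

Lemma profile_le_refl k : profile_le k k.
Proof. by case: k => L s; split=> //=; elim: s => //= -[x L1] s IH; split. Qed.

Lemma mor_dwalk (G D : lgraph X) (f : mor G D) u p v :
  dwalk u p v -> dwalk (mvert f u) (map (medge f) p) (mvert f v).
Proof.
elim: p u => [|e p IH] u /=; first by move/eqP=> ->.
by case/andP=> /eqP <- /IH h; rewrite mor_source eqxx mor_target.
Qed.

Lemma mor_glang (G D : lgraph X) (f : mor G D) u :
  lang_le (glang u) (glang (mvert f u)).
Proof.
move=> w [v [p [h <-]]]; exists (mvert f v), (map (medge f) p).
split; first exact: mor_dwalk.
by rewrite -map_comp; apply: eq_map => e /=; rewrite mor_label.
Qed.

Definition hom (G D : lgraph X) : Prop := inhabited (mor G D).

Lemma profile_hom (S T : ltree X) :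
  hom S T -> profile_le (profile S) (profile T).
Proof.
case=> f; have := mor_dwalk f (path_toP (stop S)).
rewrite mor_start mor_stop => /profileE ->; split=> /=.
  by rewrite -(mor_start f); apply: mor_glang.
elim: (path_to _) => //= e p IH; split=> //; first by rewrite mor_label.
by rewrite mor_target; apply: mor_glang.
Qed.

Definition mor_comp (G D K : lgraph X) (f : mor G D) (g : mor D K) : mor G K.
Proof.
by refine (@Mor X G K (mvert g \o mvert f) (medge g \o medge f) _ _ _ _ _) => *;
  rewrite /= ?(mor_source, mor_target, mor_label, mor_start, mor_stop).
Defined.

Lemma hom_trans (G D K : lgraph X) : hom G D -> hom D K -> hom G K.
Proof. by case=> f [g]; split; apply: mor_comp f g. Qed.

(** Moving the distinguished vertices lets each factor of a gluing be mapped onto its own segment of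
    one fixed graph. *)
Definition at_ends (G : lgraph X) (u v : vertex G) : lgraph X :=
  @LGraph X (vertex G) (edge G) (@source X G) (@target X G) (@label X G) u v.

Lemma at_endsE (G : lgraph X) : at_ends (start G) (stop G) = G.
Proof. by case: G. Qed.

Section Copair.
Variables (G D T : lgraph X) (u v w : vertex T).
Variables (f : mor G (at_ends u w)) (g : mor D (at_ends w v)).

Definition copair_vert (z : vertex (glue_graph G D)) : vertex T :=
  match z with inl a => mvert f a | inr b => mvert g (val b) end.

Definition copair_edge (e : edge (glue_graph G D)) : edge T :=
  match e with inl a => medge f a | inr b => medge g b end.

Lemma copair_inr (b : vertex D) : copair_vert (glue_inr G b) = mvert g b.
Proof.
rewrite /glue_inr; case: insubP => [a _ <- //|/negbNE/eqP->] /=.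
by rewrite (mor_stop f) (mor_start g).
Qed.

(** Gluing is a pushout over one vertex: [f] ends and [g] starts at [w], so together they define a
    morphism. *)
Definition copair : mor (glue_graph G D) (at_ends u v).
Proof.
refine (@Mor X (glue_graph G D) (at_ends u v) copair_vert copair_edge
  _ _ _ _ _).
- case=> e; first exact: (mor_source f e).
  by rewrite /= copair_inr; exact: (mor_source g e).
- case=> e; first exact: (mor_target f e).
  by rewrite /= copair_inr; exact: (mor_target g e).
- by case=> e; [exact: (mor_label f e)|exact: (mor_label g e)].
- exact: (mor_start f).
- by rewrite /= copair_inr; exact: (mor_stop g).
Defined.

End Copair.

(* The trees whose morphisms into any graph are detected by profiles. *)
Definition fitting (S : ltree X) : Prop :=
  forall (G : lgraph X) (u v : vertex G) p, dwalk u p v ->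
  profile_le (profile S) (gprofile u p) -> hom S (at_ends u v).

Lemma hom_eps (G : lgraph X) (u : vertex G) : hom (@eps X) (at_ends u u).
Proof.
by split; apply: (@Mor X eps (at_ends u u) (fun=> u)
  (fun e => match e with end)).
Qed.

Lemma hom_single (G : lgraph X) (e : edge G) :
  hom (single (label e)) (at_ends (source e) (target e)).
Proof.
by split; apply: (@Mor X (single (label e)) (at_ends (source e) (target e))
  (fun b : bool => if b then target e else source e) (fun=> e)).
Qed.

Lemma fitting_eps : fitting (@eps X).
Proof.
move=> G u v [|e p] /= h; rewrite profile_eps => -[_ //= _].
by rewrite -(eqP h); apply: hom_eps.
Qed.

Lemma fitting_single x : fitting (single x).
Proof.
move=> G u v p h; rewrite profile_single => -[_].
case: p h => //= e [|e' p] //= h [-> _ []].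
by case/andP: h => /eqP <- /eqP <-; apply: hom_single.
Qed.

(** Cut [p] after [size s] edges. Multiplication only enlarges the languages of the factors, so
    domination of the product gives domination of each factor. *)
Lemma pmul_le_split (G : lgraph X) (u v : vertex G) p L s k :
  dwalk u p v -> profile_le (pmul_rec L s k) (gprofile u p) ->
  exists p1 p2 w, [/\ dwalk u p1 w, dwalk w p2 v,
    profile_le (L, s) (gprofile u p1) & profile_le k (gprofile w p2)].
Proof.
elim: s L u p => [|[x L1] s IH] L u p hp.
  case=> h1 h2; exists [::], p, u; split=> //; first by rewrite /=.
    by split=> // w hw; apply: h1; left.
  by split=> // w hw; apply: h1; right.
case: p hp => [|e p] /= hp [h1] //= [-> h2 h3].
case/andP: hp => /eqP hu hp.
have [p1 [p2 [w [w1 w2 [l1 t1] l2]]]] := IH L1 _ _ hp (conj h2 h3).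
exists (e :: p1), p2, w; split=> //=; first by rewrite hu eqxx.
by split=> // z hz; apply: h1; left.
Qed.

Lemma fitting_glue S T : fitting S -> fitting T -> fitting (glue S T).
Proof.
move=> fS fT G u v p hp; rewrite profile_glue.
rewrite [profile S]surjective_pairing /= => /(pmul_le_split hp).
case=> p1 [p2 [w [w1 w2 l1 l2]]].
rewrite -surjective_pairing in l1.
have [f] := fS _ _ _ _ w1 l1; have [g] := fT _ _ _ _ w2 l2.
by split; apply: copair f g.
Qed.

Lemma hom_path_of (G : lgraph X) (u v : vertex G) p :
  dwalk u p v -> hom (path_of [seq label e | e <- p]) (at_ends u v).
Proof.
rewrite /path_of; elim: p u => [|e p IH] u /=.
  by rewrite big_nil => /eqP->; apply: hom_eps.
case/andP=> /eqP <- /IH[f]; rewrite big_cons; have [g] := hom_single e.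
by split; apply: copair g f.
Qed.

(** A path maps to any place where its label word can be read. A branching tree would also need the
    images of its paths to share edges, which languages do not detect. *)
Lemma fitting_path_tree (B : ltree X) (v : vertex B) : fitting (path_tree v).
Proof.
rewrite path_treeE => G u z p hp; rewrite profile_plus => -[h].
case: p hp h => //= hp h _; rewrite -(eqP hp).
have /h[y [q [hq e]]] : (profile (path_of (word_to v))).1 (word_to v).
  by rewrite profile_path_of; apply/vword_psingle; exists [::]; rewrite cats0.
have [f] := hom_path_of hq; rewrite e in f; split.
exact: (@Mor X (plus (path_of (word_to v))) (at_ends u u) (mvert f) (medge f)
  (mor_source f) (mor_target f) (mor_label f) (mor_start f) (mor_start f)).
Qed.

Lemma fitting_splay_branch (B : ltree X) : fitting (splay_branch B).
Proof.
rewrite /splay_branch; elim/big_rec: _ => [|v T _ fT]; first exact: fitting_eps.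
exact/fitting_glue/fT/fitting_path_tree.
Qed.

Lemma fitting_unbranch (B0 : ltree X) (s : seq (X * ltree X)) :
  fitting (unbranch (@splay_branch X) B0 s).
Proof.
rewrite /unbranch; elim/last_ind: s => [|s [x B] IH].
  exact: fitting_splay_branch.
rewrite foldl_rcons; apply: fitting_glue; last exact: fitting_splay_branch.
exact/fitting_glue/fitting_single.
Qed.

Lemma fitting_hom (S T : ltree X) :
  fitting S -> profile_le (profile S) (profile T) -> hom S T.
Proof.
by move=> fS h; have := fS _ _ _ _ (path_toP (stop T)) h; rewrite at_endsE.
Qed.

End Comparison.

(** * Pruning *)

Lemma iter_idempotent (V : finType) (f : V -> V) :
  exists n, forall v, iter n.+1 f (iter n.+1 f v) = iter n.+1 f v.
Proof.
pose F (i : 'I_(#|{ffun V -> V}|.+1)) := [ffun v => iter i f v].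
have : ~~ injectiveb F.
  apply/negP => /injectiveP /leq_card; by rewrite card_ord ltnn.
case/injectivePn=> i [j nij eF].
wlog lij : i j nij eF / i < j.
  move=> W; have [|h|/val_inj h] := ltngtP i j; first exact: W.
    by apply: (W j i); rewrite // eq_sym.
  by rewrite h eqxx in nij.
have per k t v : iter (t + i + k * (j - i)) f v = iter (t + i) f v.
  elim: k => [|k IH]; first by rewrite addn0.
  have -> : t + i + k.+1 * (j - i) = t + k * (j - i) + j by nia.
  have /ffunP/(_ v) := eF; rewrite !ffunE => eij.
  by rewrite iterD -eij -iterD -IH; congr iter; lia.
(* The powers of [f] have period [j - i] from [i] on; the exponent [i.+1 * (j - i)] is a positive
   multiple of the period and exceeds [i]. *)
exists (i.+1 * (j - i)).-1 => v; rewrite prednK; last first.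
  by rewrite muln_gt0 subn_gt0.
rewrite -iterD; have := per i.+1 (i.+1 * (j - i) - i) v.
by rewrite subnK //; nia.
Qed.

Lemma inj_surj_bij (V W : finType) (f : V -> W) :
  injective f -> (forall y, exists x, f x = y) -> bijective f.
Proof.
move=> fI fS; have h y : exists x, f x == y by have [x <-] := fS y; exists x.
have K : cancel (fun y => xchoose (h y)) f.
  by move=> y; apply/eqP; exact: (xchooseP (h y)).
by exists (fun y => xchoose (h y)) => // x; apply: fI; rewrite K.
Qed.

Lemma bij_of_comps (V W : Type) (f : V -> W) (g : W -> V) :
  bijective (g \o f) -> bijective (f \o g) -> bijective f.
Proof.
case=> h hK _ [k _ kK]; exists (g \o k) => [x|y]; last exact: kK.
by apply: (can_inj hK); rewrite /= [f (g _)]kK.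
Qed.

(** An injective morphism carries cycles to cycles. It serves for subgraphs of trees: images of
    endomorphisms and the two halves of a cut. *)
Lemma mor_inj_acyclic (X : Type) (G D : lgraph X) (f : mor G D) :
  injective (mvert f) -> injective (medge f) -> uacyclic D -> uacyclic G.
Proof.
move=> fV fE acD u p; apply/negP => /and4P[p0 hw ue uv].
pose q : seq (dart D) := [seq (medge f d.1, d.2) | d <- p].
have src d : dsource ((medge f d.1, d.2) : dart D) = mvert f (dsource d).
  by case: d => e []; rewrite /dsource /= ?mor_source ?mor_target.
have tgt d : dtarget ((medge f d.1, d.2) : dart D) = mvert f (dtarget d).
  by case: d => e []; rewrite /dtarget /= ?mor_source ?mor_target.
have /negP[] := acD (mvert f u) q; apply/and4P; split.
- by rewrite /q; case: (p) p0.
- move: (u) {2 4}u hw; rewrite /q; elim: (p) => [|d r IH] w z /=.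
    by move/eqP=> ->.
  by case/andP=> /eqP <- /IH; rewrite src tgt eqxx.
- have -> : [seq d.1 | d <- q] = map (medge f) [seq d.1 | d <- p].
    by rewrite -!map_comp.
  by rewrite map_inj_uniq.
- have -> : [seq dsource d | d <- q] = map (mvert f) [seq dsource d | d <- p].
    by rewrite -!map_comp; apply: eq_map => d; apply: src.
  by rewrite map_inj_uniq.
Qed.

Section Retracts.
Variable X : Type.
Implicit Types S T P Q : ltree X.

(** An edge of a tree is determined by its target, so statements about morphisms need checking on
    vertices only. *)
Lemma mor_edge_eq S T (f g : mor S T) :
  mvert f =1 mvert g -> medge f =1 medge g.
Proof. by move=> h e; apply: target_inj; rewrite !mor_target h. Qed.

Lemma iso_hom (G D : lgraph X) : iso G D -> hom G D.
Proof. by case=> f _. Qed.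

Definition mor_id (G : lgraph X) : mor G G :=
  @Mor X G G id id (fun=> erefl) (fun=> erefl) (fun=> erefl) erefl erefl.

Lemma mor_iter (G : lgraph X) (f : mor G G) n :
  exists g : mor G G, mvert g = iter n (mvert f).
Proof.
elim: n => [|n [g hg]]; first by exists (mor_id G).
by exists (mor_comp g f); rewrite /= hg.
Qed.

(* Some positive power of an endomorphism is idempotent. *)
Lemma pruned_endo_bij P (f : mor P P) :
  pruned P -> bijective (mvert f) /\ bijective (medge f).
Proof.
move=> prP; have [n hn] := iter_idempotent (mvert f).
have [g hg] := mor_iter f n.+1.
have gV v : mvert g (mvert g v) = mvert g v by rewrite hg hn.
have /prP[idV _] : retraction g.
  by split=> // e; apply: (mor_edge_eq (f := mor_comp g g)) => v; apply: gV.
have iV v : iter n.+1 (mvert f) v = v by rewrite -hg idV.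
have fV : injective (mvert f).
  by move=> u v h; rewrite -(iV u) -(iV v) !iterSr h.
have fE : injective (medge f).
  move=> d e h; apply: target_inj; apply: fV.
  by rewrite -!mor_target h.
by split; apply: injF_bij.
Qed.

(** Both composites are endomorphisms of pruned trees, hence bijective; they need not be
    identities. *)
Lemma pruned_hom_iso (P Q : ltree X) :
  pruned P -> pruned Q -> hom P Q -> hom Q P -> iso P Q.
Proof.
move=> hP hQ [f] [g]; exists f.
have [v1 e1] := pruned_endo_bij (mor_comp f g) hP.
have [v2 e2] := pruned_endo_bij (mor_comp g f) hQ.
by split; [exact: bij_of_comps v1 v2|exact: bij_of_comps e1 e2].
Qed.

Definition corestrict (G : lgraph X) (f : mor G G) : mor G (image_graph f).
Proof.
refine (@Mor X G (image_graph f)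
  (fun v => exist _ (mvert f v) (codom_f (mvert f) v))
  (fun e => exist _ (medge f e) (codom_f (medge f) e)) _ _ _ _ _).
- by move=> e; apply: val_inj; rewrite /= mor_source.
- by move=> e; apply: val_inj; rewrite /= mor_target.
- by move=> e; rewrite /= mor_label.
- by apply: val_inj; rewrite /= mor_start.
- by apply: val_inj; rewrite /= mor_stop.
Defined.

Definition image_incl (G : lgraph X) (f : mor G G) : mor (image_graph f) G :=
  @Mor X (image_graph f) G val val
    (fun=> erefl) (fun=> erefl) (fun=> erefl) erefl erefl.

Lemma image_reachable T (f : mor T T) : reachable (image_graph f).
Proof.
move=> [_ /[dup]/codomP[v ->] hv]; have [p hp] := ltree_reachable v.
exists (map (medge (corestrict f)) p).
have := mor_dwalk (corestrict f) hp; rewrite mor_start.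
by congr (is_true (dwalk _ _ _)); apply: val_inj.
Qed.

Lemma image_is_tree T (f : mor T T) : is_tree (image_graph f).
Proof.
split; first exact: reachable_connected (image_reachable (f:=f)).
by apply: (mor_inj_acyclic (f := image_incl f)) (@ltree_acyclic X T);
  apply: val_inj.
Qed.

Definition image_tree T (f : mor T T) : ltree X :=
  LTree (image_is_tree f) (image_reachable (f:=f)).

(** Unlike a retraction with its image subtype, this form composes directly, as the induction in
    [pruned_retract] requires. *)
Definition retract_of T P : Prop :=
  exists (f : mor T P) (g : mor P T), cancel (mvert g) (mvert f).

Lemma retract_pruning T P : pruned P -> retract_of T P -> is_pruning T P.
Proof.
move=> prP [f [g gK]]; split=> //; exists (mor_comp f g).
have gKe : cancel (medge g) (medge f).
  exact: (mor_edge_eq (f := mor_comp g f) (g := mor_id P)).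
split; first by split=> v /=; rewrite ?gK ?gKe.
exists (mor_comp (image_incl _) f); split.
  exists (mvert (mor_comp g (corestrict (mor_comp f g)))).
    by move=> [_ /[dup]/codomP[v ->] hv]; apply: val_inj; rewrite /= !gK.
  by move=> v /=; rewrite !gK.
exists (medge (mor_comp g (corestrict (mor_comp f g)))).
  by move=> [_ /[dup]/codomP[v ->] hv]; apply: val_inj; rewrite /= !gKe.
by move=> v /=; rewrite !gKe.
Qed.

Lemma pruned_retract T : exists2 P : ltree X, pruned P & retract_of T P.
Proof.
have [n] := ubnP #|vertex T|; elim: n => // n IH in T *; rewrite ltnS => hn.
have [prT|nprT] := excluded_middle_informative (pruned T).
  by exists T => //; exists (mor_id T), (mor_id T).
have [f rf nf] : exists2 f : mor T T, retraction f & ~ (mvert f =1 id).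
  apply: NNPP => h; apply: nprT => f rf.
  have idV : mvert f =1 id.
    by apply: NNPP => nf; apply: h; exists f.
  by split=> //; apply: (mor_edge_eq (g := mor_id T)).
have [fV fE] := rf.
have [v nv] : exists v, mvert f v <> v.
  by apply: NNPP => h; apply: nf => v; apply: NNPP => nv; apply: h; exists v.
have [|P prP [g [h hK]]] := IH (image_tree f).
  (* A retraction fixes its image pointwise, so the moved vertex [v] lies outside it and the image
     is smaller. *)
  apply: leq_trans hn; rewrite card_sig; apply/proper_card/properP.
  split; first exact/subsetP.
  by exists v => //; apply/codomP => -[u e]; apply: nv; rewrite e fV.
exists P => //; exists (mor_comp (corestrict f) g), (mor_comp h (image_incl f)).
move=> v' /=; rewrite -[RHS]hK; congr (mvert g _); apply: val_inj => /=.
by case: (mvert h v') => _ /=/codomP[u ->]; rewrite fV.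
Qed.

Lemma prune_spec T : is_pruning T (prune T).
Proof.
apply: (epsilon_spec (inhabits T) (is_pruning T)).
by have [P prP /(retract_pruning prP)] := pruned_retract T; exists P.
Qed.

Lemma pruned_prune T : pruned (prune T).
Proof. by case: (prune_spec T). Qed.

Lemma hom_prune T : hom T (prune T).
Proof.
have [_ [f [_ /iso_hom h]]] := prune_spec T.
by apply: hom_trans h; split; apply: corestrict.
Qed.

Lemma prune_hom T : hom (prune T) T.
Proof.
have [_ [f [_ /iso_sym/iso_hom h]]] := prune_spec T.
by apply: hom_trans h _; split; apply: image_incl.
Qed.

Lemma profile_hom_eq S T : hom S T -> hom T S -> profile S = profile T.
Proof. by move=> h h'; apply: profile_le_anti; apply: profile_hom. Qed.

Lemma profile_iso S T : iso S T -> profile S = profile T.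
Proof.
by move=> h; apply: profile_hom_eq; apply: iso_hom => //; apply: iso_sym.
Qed.

Lemma profile_prune T : profile (prune T) = profile T.
Proof. by apply: profile_hom_eq; [apply: prune_hom|apply: hom_prune]. Qed.

End Retracts.

(** * Branch decompositions *)

Section Cut.
Variables (X : Type) (T : ltree X) (e : edge T).
Implicit Types (v : vertex T) (f : edge T).

Definition below v : bool := e \in path_to v.

Lemma below_target f : below (target f) = below (source f) || (f == e).
Proof. by rewrite /below path_to_target mem_rcons inE orbC eq_sym. Qed.

(** Otherwise a prefix of the path to [source e] would be the path to [target e], which is
    longer. *)
Lemma below_source : ~~ below (source e).
Proof.
apply/negP => h; have := path_toP (source e).
have [p1 [p2 ep]] : exists p1 p2, path_to (source e) = p1 ++ e :: p2.
  by case/splitPr: h => p1 p2; exists p1, p2.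
rewrite ep -cat_rcons => /dwalk_cat[w [h1 _]].
have /dwalk_rcons[_ hw] := h1; rewrite -hw in h1.
move/path_toE: h1; rewrite path_to_target ep => /(congr1 size).
by rewrite !size_rcons size_cat /=; lia.
Qed.

Lemma below_start : ~~ below (start T).
Proof. by rewrite /below path_to_start. Qed.

Lemma below_target_self : below (target e).
Proof. by rewrite below_target eqxx orbT. Qed.

Lemma top_source f : ~~ below (target f) -> ~~ below (source f).
Proof. by rewrite below_target negb_or => /andP[]. Qed.

Lemma bottom_target f : below (source f) -> below (target f).
Proof. by rewrite below_target => ->. Qed.

(** Edges are kept by their target here and by their source in [bottom_graph]; exactly [e] is in
    neither, since its target is below and its source is not. *)
Definition top_graph : lgraph X :=
  @LGraph X {v | ~~ below v} {f | ~~ below (target f)}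
    (fun a => exist (fun v => ~~ below v) _ (top_source (valP a)))
    (fun a => exist (fun v => ~~ below v) _ (valP a))
    (fun a => label (val a))
    (exist (fun v => ~~ below v) _ below_start)
    (exist (fun v => ~~ below v) _ below_source).

Definition bottom_graph : lgraph X :=
  @LGraph X {v | below v} {f | below (source f)}
    (fun a => exist (fun v => below v) _ (valP a))
    (fun a => exist (fun v => below v) _ (bottom_target (valP a)))
    (fun a => label (val a))
    (exist (fun v => below v) _ below_target_self)
    (exist (fun v => below v) _ below_target_self).

Definition top_incl : mor top_graph (at_ends (start T) (source e)) :=
  @Mor X top_graph (at_ends (start T) (source e)) val val
    (fun=> erefl) (fun=> erefl) (fun=> erefl) erefl erefl.

Definition bottom_incl : mor bottom_graph (at_ends (target e) (target e)) :=
  @Mor X bottom_graph (at_ends (target e) (target e)) val val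
    (fun=> erefl) (fun=> erefl) (fun=> erefl) erefl erefl.

Lemma top_reachable : reachable top_graph.
Proof.
suff h v (hv : ~~ below v) :
    exists p, dwalk (start top_graph) p (exist _ v hv : vertex top_graph).
  by case=> v hv; apply: h.
elim/vertex_ind: v hv => [|f IH] hv; first by exists [::]; apply/eqP/val_inj.
have [p hp] := IH (top_source hv); pose f' : edge top_graph := exist _ f hv.
exists (rcons p f'); apply/dwalk_rcons; split; last exact: val_inj.
by move: hp; congr (is_true (dwalk _ _ _)); apply: val_inj.
Qed.

Lemma bottom_reachable : reachable bottom_graph.
Proof.
suff h v (hv : below v) :
    exists p, dwalk (start bottom_graph) p (exist _ v hv : vertex bottom_graph).
  by case=> v hv; apply: h.
elim/vertex_ind: v hv => [|f IH] hv; first by have := below_start; rewrite hv.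
have [/eqP fe|nfe] := boolP (f == e).
  by exists [::]; apply/eqP/val_inj; rewrite /= fe.
have hs : below (source f) by move: hv; rewrite below_target (negbTE nfe) orbF.
have [p hp] := IH hs; pose f' : edge bottom_graph := exist _ f hs.
exists (rcons p f'); apply/dwalk_rcons; split; last exact: val_inj.
by move: hp; congr (is_true (dwalk _ _ _)); apply: val_inj.
Qed.

Lemma top_is_tree : is_tree top_graph.
Proof.
split; first exact: reachable_connected top_reachable.
by apply: (mor_inj_acyclic (f := top_incl)) (@ltree_acyclic X T);
  apply: val_inj.
Qed.

Lemma bottom_is_tree : is_tree bottom_graph.
Proof.
split; first exact: reachable_connected bottom_reachable.
by apply: (mor_inj_acyclic (f := bottom_incl)) (@ltree_acyclic X T);
  apply: val_inj.
Qed.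

Definition top : ltree X := LTree top_is_tree top_reachable.
Definition bottom : ltree X := LTree bottom_is_tree bottom_reachable.

Lemma cut_iso :
  iso (glue (glue top (single (label e))) bottom)
    (at_ends (start T) (target e)).
Proof.
pose s : mor (single (label e)) (at_ends (source e) (target e)) :=
  @Mor X (single (label e)) (at_ends (source e) (target e))
    (fun b : bool => if b then target e else source e) (fun=> e)
    (fun=> erefl) (fun=> erefl) (fun=> erefl) erefl erefl.
exists (copair (copair top_incl s) bottom_incl); split; apply: inj_surj_bij.
- have nt (w : {v | ~~ below v}) : val w != target e.
    apply: contraNneq (valP w) => ->; exact: below_target_self.
  have tb (w : {v | ~~ below v}) (w' : {v | below v}) : val w != val w'.
    apply: contraNneq (valP w) => ->; exact: valP.
  move=> [[w|[[] // hb]]|[w hw]] [[w'|[[] // hb']]|[w' hw']] //= h.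
  + by congr (inl (inl _)); apply: val_inj.
  + by case/eqP: (nt w).
  + by case/eqP: (tb w w').
  + by case/eqP: (nt w').
  + by congr (inl (inr _)); apply: val_inj.
  + by case/eqP: hw'; apply: val_inj.
  + by case/eqP: (tb w' w).
  + by case/eqP: hw; apply: val_inj.
  + by congr inr; apply: val_inj; apply: val_inj.
- move=> v; have [hv|hv] := boolP (below v); last first.
    by exists (inl (inl (exist _ v hv))).
  (* Gluing drops the start vertex of the bottom part, so [target e] is hit by the end of the single
     edge. *)
  have [->|nv] := eqVneq v (target e).
    exists (inl (@glue_inr X top_graph (single_graph (label e)) true)).
    exact: (copair_inr top_incl s true).
  have nw : (exist _ v hv : vertex bottom_graph) != start bottom_graph.
    by apply: contra_neq nv => /(congr1 val).
  by exists (inr (exist (fun w => w != start bottom_graph) _ nw)).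
- have te (f : {f | ~~ below (target f)}) : val f != e.
    apply: contraNneq (valP f) => ->; exact: below_target_self.
  have be (f : {f | below (source f)}) : val f != e.
    apply/eqP => h; have := below_source; rewrite -h; exact/negP/negPn/(valP f).
  have tb (f : {f | ~~ below (target f)}) (g : {f | below (source f)}) :
    val f != val g.
    apply: contraNneq (valP f) => ->; exact/bottom_target/(valP g).
  move=> [[f|[]]|f] [[g|[]]|g] //= h.
  + by congr (inl (inl _)); apply: val_inj.
  + by case/eqP: (te f).
  + by case/eqP: (tb f g).
  + by case/eqP: (te g).
  + by case/eqP: (be g).
  + by case/eqP: (tb g f).
  + by case/eqP: (be f).
  + by congr inr; apply: val_inj.
- move=> f; have [ht|ht] := boolP (below (target f)); last first.
    by exists (inl (inl (exist _ f ht))).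
  have [->|nf] := eqVneq f e; first by exists (inl (inr tt)).
  have hs : below (source f) by move: ht; rewrite below_target (negbTE nf) orbF.
  by exists (inr (exist _ f hs)).
Qed.

End Cut.

(** * Existence of branch decompositions, and hats determined by profiles *)

Section Branches.
Variable X : Type.
Implicit Types S T : ltree X.

Lemma iso_glue_l (G G' D : lgraph X) :
  iso G G' -> iso (glue_graph G D) (glue_graph G' D).
Proof.
case=> f [[gv vK gvK] [ge eK geK]].
pose F (z : vertex (glue_graph G D)) : vertex (glue_graph G' D) :=
  match z with inl a => inl (mvert f a) | inr b => inr b end.
pose Fe (z : edge (glue_graph G D)) : edge (glue_graph G' D) :=
  match z with inl a => inl (medge f a) | inr b => inr b end.
have Fr b : F (glue_inr G b) = glue_inr G' b.
  by rewrite /glue_inr; case: insubP => //= _; rewrite mor_stop.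
unshelve eexists (@Mor X _ _ F Fe _ _ _ _ _).
- by case=> a; rewrite /= ?mor_source ?Fr.
- by case=> a; rewrite /= ?mor_target ?Fr.
- by case=> a //=; rewrite mor_label.
- by rewrite /= mor_start.
- by rewrite /= Fr.
split; [exists (fun z => match z with inl a => inl (gv a) | inr b => inr b end)
  |exists (fun z => match z with inl a => inl (ge a) | inr b => inr b end)];
  by case=> a //=; rewrite ?vK ?gvK ?eK ?geK.
Qed.

Lemma cut_stop T : start T != stop T ->
  exists S B x, in_E B /\ iso T (glue (glue S (single x)) B).
Proof.
move=> nT; have := path_toP (stop T).
case/lastP: (path_to _) => [|p e]; first by rewrite /= (negbTE nT).
case/dwalk_rcons=> _ he; exists (top e), (bottom e), (label e).
split; first exact: eqxx.
by apply: iso_sym; have := cut_iso e; rewrite he at_endsE.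
Qed.

(** Cut at the last trunk edge: the part below it is the last branch, and the part above has fewer
    edges. *)
Lemma branch_decomposition_exists T :
  exists B0 s, branch_decomposition T B0 s.
Proof.
have [n] := ubnP #|edge T|; elim: n => // n IH in T *; rewrite ltnS => hn.
have [hT|/cut_stop[S [B [x [hB hT]]]]] := boolP (start T == stop T).
  by exists T, [::]; split=> //; apply: iso_refl.
have [|B0 [s [h0 hs hS]]] := IH S.
  apply: leq_trans hn; rewrite (iso_card_edge hT) !card_edge_glue.
  by rewrite card_unit; lia.
exists B0, (rcons s (x, B)); split=> //; first by rewrite all_rcons hB.
rewrite /unbranch foldl_rcons; apply: iso_trans hT _.
exact/iso_glue_l/iso_glue_l.
Qed.

Lemma splay_spec T : is_splaying T (splay T).
Proof.
apply: (epsilon_spec (inhabits T) (is_splaying T)).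
have [B0 [s h]] := branch_decomposition_exists T.
by exists (unbranch (@splay_branch X) B0 s), B0, s.
Qed.

Lemma profile_splay T : profile (splay T) = profile T.
Proof.
have [B0 [s [[h0 hs hT] ->]]] := splay_spec T.
by rewrite profile_unbranch // -(profile_iso hT).
Qed.

Lemma fitting_splay T : fitting (splay T).
Proof. by have [B0 [s [_ ->]]] := splay_spec T; apply: fitting_unbranch. Qed.

Lemma profile_hat T : profile (hat T) = profile T.
Proof. by rewrite profile_prune profile_splay. Qed.

Lemma hat_iso S T : profile S = profile T -> iso (hat S) (hat T).
Proof.
(* The morphism passes through [splay S'] and [splay T']; the middle step exists because [splay S']
   is fitting. *)
have h S' T' : profile S' = profile T' -> hom (hat S') (hat T').
  move=> e; apply: hom_trans (prune_hom _) _; apply: hom_trans (hom_prune _).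
  apply: fitting_hom; first exact: fitting_splay.
  by rewrite !profile_splay e; apply: profile_le_refl.
by move=> e; apply: pruned_hom_iso; try exact: pruned_prune; apply: h.
Qed.

End Branches.

(** * The algebra H(X) *)

Section FreeAlgebra.
Variable X : Type.
Implicit Types (T : ltree X) (c d : H X).

Definition hprofile c : profiles X := profile (hrepr c).

Lemma hreprP c : hclass c (hrepr c).
Proof. by rewrite /hrepr; case: constructive_indefinite_description. Qed.

Lemma hprofileE c T : hclass c = tclass T -> hprofile c = profile T.
Proof. by move=> e; have := hreprP c; rewrite e => /profile_iso. Qed.

Lemma hprofile_hat_class T : hprofile (hat_class T) = profile T.
Proof. by rewrite (hprofileE (T := hat T)) // profile_hat. Qed.

Lemma hprofile_gen x : hprofile (H_gen x) = psingle x.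
Proof. by rewrite (hprofileE (T := single x)) // profile_single. Qed.

Lemma hprofile_inj : injective hprofile.
Proof.
move=> c d; case: (hclassP c) (hclassP d) => S hS [T hT].
rewrite (hprofileE hS) (hprofileE hT) !profile_hat => /hat_iso/tclass_eq.
rewrite -hS -hT; case: c d {hS hT} => [c pc] [d pd] /= e; subst d.
by rewrite (proof_irrelevance _ pc pd).
Qed.

Lemma hprofile_wf c : wf (hprofile c).
Proof. exact: profile_wf. Qed.

Lemma hprofile_morphism : morphism210 hprofile.
Proof.
split=> [c d|c|].
- by rewrite hprofile_hat_class profile_glue.
- by rewrite hprofile_hat_class profile_plus.
- by rewrite (hprofileE (T := eps)) // profile_eps.
Qed.

Lemma H_left_h_adequate : left_h_adequate_monoid (H X).
Proof.
exact: profiles_left_h_adequate hprofile_morphism hprofile_inj hprofile_wf.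
Qed.

(** This says that the generators generate [H X]. The identity is checked after applying the
    injective [hprofile], where the evaluation takes place in [profiles]. *)
Lemma value_hprofile c : value (M := H X) (@H_gen X) (hprofile c) = c.
Proof.
apply: hprofile_inj; rewrite (morphism_value _ _ hprofile_morphism).
have -> : hprofile \o @H_gen X = @psingle X.
  by apply: functional_extensionality => x; apply: hprofile_gen.
exact/value_profiles/hprofile_wf.
Qed.

End FreeAlgebra.

Theorem corollary4p11 (X : Type) (X_nonempty : inhabited X) :
  left_h_adequate_monoid (H X) /\
  forall M : alg210, left_h_adequate_monoid M ->
  forall chi : X -> M,
  exists! f : H X -> M,
    morphism210 f /\ forall x : X, f (H_gen x) = chi x.
Proof.
split; first exact: H_left_h_adequate.
move=> M hM chi; have [pM pP p1] := hprofile_morphism X.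
exists (fun c => value chi (hprofile c)); split.
  split; last by move=> x; rewrite hprofile_gen value_single.
  split=> [c d|c|]; rewrite ?(pM, pP, p1).
  - by apply: value_mul => //; apply: hprofile_wf.
  - by apply: value_plus => //; apply: hprofile_wf.
  - exact: value_one.
move=> f [fM fX]; apply: functional_extensionality => c.
(* Any extension [f] commutes with evaluation, so its value at [c] is determined by [chi] and the
   profile of [c]. *)
rewrite -[in RHS](value_hprofile c) (morphism_value _ _ fM).
by congr value; apply: functional_extensionality => x; rewrite /= fX.
Qed.
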